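(* Let $(\mu_0,u_0)$ be admissible initial data (in particular the support of $\mu_0$ is $\mathbb{R}$), with sticky particle flow $\phi$, velocity field $u$, process $X_t=\phi_{0,t}(X_0)$, first shock time $\gamma=\tau(X_0)$ and processes $Z^1,Z^2,Z^3,Z^4$ (all defined in the context). Then, almost everywhere: 1. If $Z$ stands for any one of $Z^1,Z^2,Z^3,Z^4$, then for all $t,s\ge0$, $$Z_{s+t}=\phi_{s,t}(Z_s),\qquad \frac{d}{dt}Z_t=u(Z_t,t),$$ where $\frac{d}{dt}$ is the right-hand derivative. 2. If $Z$ stands for any one of $Z^1,Z^2,Z^3,Z^4$, then $\tau(Z_0)=\tau(X_0)=\gamma$; for all $t\ge\gamma$, $Z_t=X_t$; and for all $t\le\gamma$, $$Z_t=Z_0+t\,u_0(Z_0),\qquad Z^3_t\le Z^1_t\le X_t\le Z^2_t\le Z^4_t .$$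
   Context: Admissible initial data: $\mu_0$ is a nonnegative Radon measure on $\mathbb{R}$ with support equal to $\mathbb{R}$; $u_0:\mathbb{R}\to\mathbb{R}$ is locally $\mu_0$-integrable, $x^{-1}u_0(x)\to0$ as $|x|\to\infty$, and the Negative Jump Condition holds: $u_0^-(x)\ge u_0(x)\ge u_0^+(x)$ for all $x$, where $$u_0^-(x)=\limsup_{\varepsilon\to0}\frac{\int_{[x-\varepsilon,x)}u_0\,d\mu_0}{\mu_0[x-\varepsilon,x)},\qquad u_0^+(x)=\liminf_{\varepsilon\to0}\frac{\int_{(x,x+\varepsilon]}u_0\,d\mu_0}{\mu_0(x,x+\varepsilon]}.$$ Sticky particle flow: such data determine a flow $(x,s,t)\mapsto\phi_{s,t}(x)$ on $\mathbb{R}\times\mathbb{R}_+\times\mathbb{R}_+$ ($\phi_{s,t}(x)$ is the position, after a supplementary time $t$, of the particle located at $x$ at time $s$; particles move freely until they collide, and collisions are perfectly inelastic, conserving mass and momentum), with the following properties. (i) $\phi_{s,0}(x)=x$; each $\phi_{s,t}(\cdot)$ is nondecreasing and continuous; $\phi_{s,t}(\phi_{0,s}(y))=\phi_{0,s+t}(y)$. (ii) Write $\phi_{0,t}^{-1}(\{x\})=[\alpha(x,0,t),\beta(x,0,t)]$ (the cluster at position $x$ at time $t$), with $\alpha=\alpha(x,0,t)$, $\beta=\beta(x,0,t)$. If $\alpha<\beta$ then $x=\mu_0([\alpha,\beta])^{-1}\int_{[\alpha,\beta]}(a+tu_0(a))\,d\mu_0(a)$; in any case $x=\alpha+tu_0(\alpha)=\beta+tu_0(\beta)$.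 (iii) If $\mu_0([\alpha,y])>0$ and $\mu_0((y,\beta])>0$, then $\mu_0((y,\beta])^{-1}\int_{(y,\beta]}(a+tu_0(a))\,d\mu_0(a)\le x\le\mu_0([\alpha,y])^{-1}\int_{[\alpha,y]}(a+tu_0(a))\,d\mu_0(a)$. (iv) For $s\le t$: $\phi_{0,s}(\alpha)=\alpha+su_0(\alpha)$ and $\phi_{0,s}(\beta)=\beta+su_0(\beta)$. Velocity field: $u(x,t)=u_t(x)$ is the function such that the right-hand derivative satisfies $\frac{\partial}{\partial t}\phi_{0,t}(y)=u_t(\phi_{0,t}(y))$ for all $y,t$; explicitly $u_t(x)=\mu_0([\alpha,\beta])^{-1}\int_{[\alpha,\beta]}u_0\,d\mu_0$ if $\alpha<\beta$, and $u_t(x)=u_0(\alpha)$ if $\alpha=\beta$, where $[\alpha,\beta]=\phi_{0,t}^{-1}(\{x\})$. Let $u^-(\cdot,t),u^+(\cdot,t)$ be the left-hand and right-hand limit functions of $u(\cdot,t)$ (for $t>0$ they equal $u_0(\alpha(\cdot,0,t))$ and $u_0(\beta(\cdot,0,t))$; for $t=0$ use $u_0^-,u_0^+$). First shock time: $\tau(a)=\inf\{t:\,u^-(\phi_{0,t}(a),t)\ne u^+(\phi_{0,t}(a),t)\}$ (with $\inf\emptyset=\infty$). Turbulent interval containing $a$: the greatest interval $[A,B]\ni a$ such that for all $a'\in[A,B]$, $\tau(a')=\tau(a)=:t$ and $\phi_{0,t}(a')=\phi_{0,t}(a)$ (it is closed). If $\tau(a)=\infty$, it is taken to be $\{a\}$.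 The turbulent intervals partition $\mathbb{R}$. Processes: on a measure space $(\Omega,\mathcal{F},P)$ let $X_0:\Omega\to\mathbb{R}$ be measurable with image measure $P\circ X_0^{-1}=\mu_0$; $X_t=\phi_{0,t}(X_0)$; $\gamma=\tau(X_0)$. If $X_0$ lies in the turbulent interval $[A,B]$ and $x=A+\tau(A)u_0(A)$, then for all $t\ge0$ $$Z^1_t=\phi_{0,t}(A),\quad Z^2_t=\phi_{0,t}(B),\quad Z^3_t=\phi_{0,t}(\alpha(x,0,\tau(A))),\quad Z^4_t=\phi_{0,t}(\beta(x,0,\tau(A))),$$ and all four are equal to $X_t$ if $\gamma=\infty$. ''Almost everywhere'' is with respect to $P$. *)

(* Defs.v *)
From HB Require Import structures.
From mathcomp Require Import all_boot all_order all_algebra.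
From mathcomp Require Import all_classical all_reals all_analysis.

Set Implicit Arguments.
Unset Strict Implicit.
Unset Printing Implicit Defensive.

Import Order.TTheory GRing.Theory Num.Theory.
Import numFieldNormedType.Exports.

Local Open Scope classical_set_scope.
Local Open Scope ring_scope.

(* Every Borel measure on R that is finite on compact sets is regular, so
   regularity need not be required separately. *)
Definition radon (R : realType)
    (mu : {measure set (measurableTypeR R) -> \bar R}) : Prop :=
  forall K : set R, compact K -> (mu K < +oo)%E.

Definition msupport (R : realType)
    (mu : {measure set (measurableTypeR R) -> \bar R}) : set R :=
  [set x | forall U : set R, open U -> U x -> (0 < mu U)%E].

(* Total in S; the mean value of f over S only when 0 < mu S < +oo and f is
   mu-integrable on S, as is the case wherever it is used below. *)
Definition average (R : realType)
    (mu : {measure set (measurableTypeR R) -> \bar R})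
    (S : set R) (f : R -> R) : R :=
  (fine (mu S))^-1 * Rintegral mu S f.

Definition u0_minus (R : realType)
    (mu0 : {measure set (measurableTypeR R) -> \bar R}) (u0 : R -> R)
    (x : R) : \bar R :=
  limf_esup (fun e : R => (average mu0 `[x - e, x[ u0)%:E) 0^'+.

Definition u0_plus (R : realType)
    (mu0 : {measure set (measurableTypeR R) -> \bar R}) (u0 : R -> R)
    (x : R) : \bar R :=
  limf_einf (fun e : R => (average mu0 `]x, x + e] u0)%:E) 0^'+.

Record admissible (R : realType)
    (mu0 : {measure set (measurableTypeR R) -> \bar R}) (u0 : R -> R) : Prop := {
  adm_radon : radon mu0 ;
  adm_support : msupport mu0 = setT ;
  adm_integrable : forall K : set R, compact K ->
    mu0.-integrable K (EFin \o u0) ;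
  adm_pinfty : x^-1 * u0 x @[x --> +oo] --> (0 : R) ;
  adm_ninfty : x^-1 * u0 x @[x --> -oo] --> (0 : R) ;
  adm_negative_jump : forall x : R,
    (u0_plus mu0 u0 x <= (u0 x)%:E)%E /\ ((u0 x)%:E <= u0_minus mu0 u0 x)%E }.

(* [phi s t x] is phi_{s,t}(x); [cluster_left phi x s t] is alpha(x,s,t) and
   [cluster_right phi x s t] is beta(x,s,t). *)
Definition cluster_left (R : realType) (phi : R -> R -> R -> R)
    (x s t : R) : R := inf (phi s t @^-1` [set x]).

Definition cluster_right (R : realType) (phi : R -> R -> R -> R)
    (x s t : R) : R := sup (phi s t @^-1` [set x]).

(* These properties determine phi on nonnegative times: the barycentre
   conditions make the integral of phi_{0,t} in the mass variable the convex
   hull of the integral of a + t u0(a), and the semigroup property together with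
   the surjectivity of phi_{0,s}, contained in [flow_cluster], then fixes
   phi_{s,t}. *)
Record sticky_flow (R : realType)
    (mu0 : {measure set (measurableTypeR R) -> \bar R}) (u0 : R -> R)
    (phi : R -> R -> R -> R) : Prop := {
  flow_id : forall s x : R, 0 <= s -> phi s 0 x = x ;
  flow_nondecreasing : forall s t : R, 0 <= s -> 0 <= t ->
    {homo phi s t : x y / x <= y} ;
  flow_continuous : forall s t : R, 0 <= s -> 0 <= t -> continuous (phi s t) ;
  flow_semigroup : forall s t y : R, 0 <= s -> 0 <= t ->
    phi s t (phi 0 s y) = phi 0 (s + t) y ;
  flow_cluster : forall x t : R, 0 <= t ->
    cluster_left phi x 0 t <= cluster_right phi x 0 t /\
    phi 0 t @^-1` [set x] =
      `[cluster_left phi x 0 t, cluster_right phi x 0 t]%classic ;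
  flow_barycentre : forall x t : R, 0 <= t ->
    let alpha := cluster_left phi x 0 t in
    let beta := cluster_right phi x 0 t in
    alpha < beta -> x = average mu0 `[alpha, beta] (fun a => a + t * u0 a) ;
  flow_endpoints : forall x t : R, 0 <= t ->
    let alpha := cluster_left phi x 0 t in
    let beta := cluster_right phi x 0 t in
    x = alpha + t * u0 alpha /\ x = beta + t * u0 beta ;
  flow_partial_barycentres : forall x y t : R, 0 <= t ->
    let alpha := cluster_left phi x 0 t in
    let beta := cluster_right phi x 0 t in
    (0 < mu0 `[alpha, y]%classic)%E -> (0 < mu0 `]y, beta]%classic)%E ->
    average mu0 `]y, beta] (fun a => a + t * u0 a) <= x /\
    x <= average mu0 `[alpha, y] (fun a => a + t * u0 a) ;
  flow_free_endpoints : forall x s t : R, 0 <= s -> s <= t ->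
    let alpha := cluster_left phi x 0 t in
    let beta := cluster_right phi x 0 t in
    phi 0 s alpha = alpha + s * u0 alpha /\
    phi 0 s beta = beta + s * u0 beta }.

Definition velocity (R : realType)
    (mu0 : {measure set (measurableTypeR R) -> \bar R}) (u0 : R -> R)
    (phi : R -> R -> R -> R) (x t : R) : R :=
  let alpha := cluster_left phi x 0 t in
  let beta := cluster_right phi x 0 t in
  if alpha < beta then average mu0 `[alpha, beta] u0 else u0 alpha.

Definition velocity_minus (R : realType)
    (mu0 : {measure set (measurableTypeR R) -> \bar R}) (u0 : R -> R)
    (phi : R -> R -> R -> R) (x t : R) : \bar R :=
  if t == 0 then u0_minus mu0 u0 x
  else (lim (velocity mu0 u0 phi y t @[y --> x^'-]))%:E.

Definition velocity_plus (R : realType)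
    (mu0 : {measure set (measurableTypeR R) -> \bar R}) (u0 : R -> R)
    (phi : R -> R -> R -> R) (x t : R) : \bar R :=
  if t == 0 then u0_plus mu0 u0 x
  else (lim (velocity mu0 u0 phi y t @[y --> x^'+]))%:E.

Definition shock_time (R : realType)
    (mu0 : {measure set (measurableTypeR R) -> \bar R}) (u0 : R -> R)
    (phi : R -> R -> R -> R) (a : R) : \bar R :=
  ereal_inf [set t%:E | t in [set t : R | 0 <= t /\
    velocity_minus mu0 u0 phi (phi 0 t a) t <>
    velocity_plus mu0 u0 phi (phi 0 t a) t]].

Definition shock_together (R : realType)
    (mu0 : {measure set (measurableTypeR R) -> \bar R}) (u0 : R -> R)
    (phi : R -> R -> R -> R) (a : R) (I : set R) : Prop :=
  let t := shock_time mu0 u0 phi a in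
  [/\ is_interval I, I a & forall a', I a' ->
    shock_time mu0 u0 phi a' = t /\
    phi 0 (fine t) a' = phi 0 (fine t) a].

(* The union of all these intervals is the greatest of them, see
   [turbulent_greatest]. *)
Definition turbulent (R : realType)
    (mu0 : {measure set (measurableTypeR R) -> \bar R}) (u0 : R -> R)
    (phi : R -> R -> R -> R) (a : R) : set R :=
  if shock_time mu0 u0 phi a == +oo%E then [set a]
  else \bigcup_(I in shock_together mu0 u0 phi a) I.

Lemma turbulent_greatest (R : realType)
    (mu0 : {measure set (measurableTypeR R) -> \bar R}) (u0 : R -> R)
    (phi : R -> R -> R -> R) (a : R) :
  shock_time mu0 u0 phi a <> +oo%E ->
  shock_together mu0 u0 phi a (turbulent mu0 u0 phi a) /\
  forall I, shock_together mu0 u0 phi a I -> I `<=` turbulent mu0 u0 phi a.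
Proof.
move=> /eqP/negbTE fin; rewrite /turbulent fin; split; last first.
  by move=> I hI x Ix; exists I.
split.
- move=> x y [I hI Ix] [J hJ Jy] z /andP[xz zy].
  have [iI Ia _] := hI; have [iJ Ja _] := hJ.
  have [za|az] := leP z a.
    by exists I => //; apply: (iI x a) => //; rewrite xz za.
  by exists J => //; apply: (iJ a y) => //; rewrite zy ltW.
- exists [set a] => //; split => //.
    move=> x y -> -> z; rewrite -eq_le => /eqP az; exact/esym.
  by move=> a' ->.
- by move=> a' [I [_ _ +] Ia'] => /(_ _ Ia').
Qed.

Definition turbulent_left (R : realType)
    (mu0 : {measure set (measurableTypeR R) -> \bar R}) (u0 : R -> R)
    (phi : R -> R -> R -> R) (a : R) : R := inf (turbulent mu0 u0 phi a).

Definition turbulent_right (R : realType)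
    (mu0 : {measure set (measurableTypeR R) -> \bar R}) (u0 : R -> R)
    (phi : R -> R -> R -> R) (a : R) : R := sup (turbulent mu0 u0 phi a).

Definition shock_position (R : realType)
    (mu0 : {measure set (measurableTypeR R) -> \bar R}) (u0 : R -> R)
    (phi : R -> R -> R -> R) (a : R) : R :=
  let A := turbulent_left mu0 u0 phi a in
  A + fine (shock_time mu0 u0 phi A) * u0 A.

(* The four processes, and X itself, as functions of the time and of the value
   a of X_0. *)
Definition X (R : realType) (phi : R -> R -> R -> R) (t a : R) : R := phi 0 t a.

Definition Z1 (R : realType)
    (mu0 : {measure set (measurableTypeR R) -> \bar R}) (u0 : R -> R)
    (phi : R -> R -> R -> R) (t a : R) : R :=
  if shock_time mu0 u0 phi a == +oo%E then X phi t a
  else phi 0 t (turbulent_left mu0 u0 phi a).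

Definition Z2 (R : realType)
    (mu0 : {measure set (measurableTypeR R) -> \bar R}) (u0 : R -> R)
    (phi : R -> R -> R -> R) (t a : R) : R :=
  if shock_time mu0 u0 phi a == +oo%E then X phi t a
  else phi 0 t (turbulent_right mu0 u0 phi a).

Definition Z3 (R : realType)
    (mu0 : {measure set (measurableTypeR R) -> \bar R}) (u0 : R -> R)
    (phi : R -> R -> R -> R) (t a : R) : R :=
  if shock_time mu0 u0 phi a == +oo%E then X phi t a
  else
    let A := turbulent_left mu0 u0 phi a in
    phi 0 t (cluster_left phi (shock_position mu0 u0 phi a) 0
               (fine (shock_time mu0 u0 phi A))).

Definition Z4 (R : realType)
    (mu0 : {measure set (measurableTypeR R) -> \bar R}) (u0 : R -> R)
    (phi : R -> R -> R -> R) (t a : R) : R :=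
  if shock_time mu0 u0 phi a == +oo%E then X phi t a
  else
    let A := turbulent_left mu0 u0 phi a in
    phi 0 t (cluster_right phi (shock_position mu0 u0 phi a) 0
               (fine (shock_time mu0 u0 phi A))).

Definition is_right_derivative (R : realType) (f : R -> R) (t l : R) : Prop :=
  h^-1 * (f (t + h) - f t) @[h --> 0^'+] --> l.

(* Main.v *)
(* Write T_t(a) = a + t u0(a).  Over the cluster of a at time t the integral of
   T_t - phi_t vanishes and its partial integrals from the left are nonnegative.

   If c is an endpoint of its cluster at time t and already belonged to a
   non-trivial cluster at a time s < t, then the mean over that earlier cluster
   of T_r - T_r(c) is affine in r, non-zero at r = 0, zero at r = s, and has at
   r = t the sign it had at r = 0: impossible.  Hence endpoints stay alone before
   t, which gives the shock time of Z^3 and Z^4, and also of Z^1 and Z^2, since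
   a limit of points of the turbulent interval that is not an endpoint of an
   earlier cluster would have neighbours in it.  Before the shock these four
   points move freely.

   For t > 0 the right-hand derivative of phi_t comes from comparing the
   barycentres of the mass absorbed in ]t, t + h] at both times.  At t = 0 it
   can fail, but only on a null set: if phi_h(a) >= a + lam h for arbitrarily
   small h, then a lies in arbitrarily short intervals all of whose initial
   segments have u0-mean at least lam, and the rising sun lemma together with
   outer regularity shows that the set of such a with u0(a) < lam is null.
   Particles with a positive shock time move freely at first, so only Z = X is
   concerned by this exceptional set. *)
Require Import Defs.
From HB Require Import structures.
From mathcomp Require Import all_boot all_order all_algebra.
From mathcomp Require Import all_classical all_reals all_analysis.
From mathcomp Require Import measurable_realfun lra.
Import Order.TTheory GRing.Theory Num.Theory.
Import numFieldNormedType.Exports.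
Local Open Scope classical_set_scope.
Local Open Scope ring_scope.

Set Implicit Arguments.
Unset Strict Implicit.
Unset Printing Implicit Defensive.

(** * Locally integrable functions *)

Section local_integrals.
Context {R : realType} (mu : {measure set (measurableTypeR R) -> \bar R}).
Hypothesis mu_fin : forall a b : R, (mu `[a, b]%classic < +oo)%E.
Implicit Types (f g : R -> R) (S : set R).

Definition loc_integrable f :=
  forall a b, mu.-integrable `[a, b]%classic (EFin \o f).

Lemma loc_integrableS f S a b : loc_integrable f ->
  measurable S -> S `<=` `[a, b] -> mu.-integrable S (EFin \o f).
Proof. by move=> fi mS Sab; apply: integrableS (fi a b). Qed.

(** A monotone function is bounded on each segment, and segments have finite mass. This covers
    constants, the identity and each [phi t]. *)
Lemma loc_integrable_nd f : {homo f : x y / x <= y} -> loc_integrable f.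
Proof.
move=> ndf a b; apply: measurable_bounded_integrable => //.
  by apply: nondecreasing_measurable => // x y *; apply: ndf.
exists (`|f a| + `|f b|); split; first exact: num_real.
move=> M abM x /=; rewrite in_itv/= => /andP[/ndf ax /ndf xb].
apply: ltW; apply: le_lt_trans abM; rewrite ler_norml.
have := ler_norm (f b); have := ler_norm (- f a); rewrite normrN.
by have := normr_ge0 (f a); have := normr_ge0 (f b); lra.
Qed.

Lemma loc_integrable_cst c : loc_integrable (fun=> c).
Proof. exact: loc_integrable_nd. Qed.

Lemma loc_integrable_id : loc_integrable id.
Proof. exact: loc_integrable_nd. Qed.

Lemma loc_integrableZ k f : loc_integrable f -> loc_integrable (fun x => k * f x).
Proof. by move=> fi a b; apply: (integrableZl _ _ (fi a b)). Qed.

Lemma loc_integrableD f g : loc_integrable f -> loc_integrable g ->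
  loc_integrable (fun x => f x + g x).
Proof. by move=> fi gi a b; apply: (integrableD _ (fi a b) (gi a b)). Qed.

Lemma loc_integrableB f g : loc_integrable f -> loc_integrable g ->
  loc_integrable (fun x => f x - g x).
Proof. by move=> fi gi a b; apply: (integrableB _ (fi a b) (gi a b)). Qed.

Lemma loc_integrable_norm f : loc_integrable f -> loc_integrable (fun x => `|f x|).
Proof. by move=> fi a b; apply: (integrable_norm (fi a b)). Qed.

Section fixed_set.
Variables (S : set R) (a b : R).
Hypotheses (mS : measurable S) (Sab : S `<=` `[a, b]).
Variables f g : R -> R.
Hypotheses (fi : loc_integrable f) (gi : loc_integrable g).

Lemma int_Z k : \int[mu]_(x in S) (k * f x) = k * \int[mu]_(x in S) f x.
Proof. by apply: RintegralZl => //; apply: loc_integrableS Sab. Qed.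

Lemma int_D : \int[mu]_(x in S) (f x + g x) =
  \int[mu]_(x in S) f x + \int[mu]_(x in S) g x.
Proof. by apply: RintegralD => //; apply: loc_integrableS Sab. Qed.

Lemma int_B : \int[mu]_(x in S) (f x - g x) =
  \int[mu]_(x in S) f x - \int[mu]_(x in S) g x.
Proof. by apply: RintegralB => //; apply: loc_integrableS Sab. Qed.

Lemma int_le : (forall x, S x -> f x <= g x) ->
  \int[mu]_(x in S) f x <= \int[mu]_(x in S) g x.
Proof. by move=> fg; apply: le_Rintegral => //; apply: loc_integrableS Sab. Qed.

End fixed_set.

Lemma int_U f S1 S2 a b : loc_integrable f -> measurable S1 -> measurable S2 ->
  S1 `<=` `[a, b] -> S2 `<=` `[a, b] -> (forall x, S1 x -> S2 x -> False) ->
  \int[mu]_(x in S1 `|` S2) f x = \int[mu]_(x in S1) f x + \int[mu]_(x in S2) f x.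
Proof.
move=> fi m1 m2 s1 s2 dis; apply: Rintegral_setU => //.
  by apply: (loc_integrableS fi (a := a) (b := b)); [exact: measurableU | rewrite subUset].
by apply/disj_setPS => x [/dis].
Qed.

(** Dominated convergence on [[a, b]] with majorant [|f|], applied to the truncations of [f] to the
    sets [S n]. *)
Lemma cvg_int f (S : nat -> set R) S0 a b : loc_integrable f ->
  (forall n, measurable (S n)) -> measurable S0 ->
  (forall n, S n `<=` `[a, b]) -> S0 `<=` `[a, b] ->
  (forall x, \forall n \near \oo, S n x <-> S0 x) ->
  \int[mu]_(x in S n) f x @[n --> \oo] --> \int[mu]_(x in S0) f x.
Proof.
move=> fi mS m0 sS s0 cv.
have mk S' : measurable S' -> S' `<=` `[a, b] ->
    (\int[mu]_(x in S') (f x)%:E = \int[mu]_(x in `[a, b]) ((f \_ S') x)%:E)%E.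
  move=> mS' S'ab; rewrite -[in LHS](setIidr S'ab) integral_mkcondr.
  by under eq_integral do rewrite restrict_EFin.
have fin S' : measurable S' -> S' `<=` `[a, b] ->
    (\int[mu]_(x in S') (f x)%:E)%E \is a fin_num.
  by move=> mS' S'ab; apply: integrable_fin_num => //; apply: loc_integrableS S'ab.
apply: fine_cvg; rewrite fineK; last exact: fin.
rewrite mk//; under eq_fun do rewrite mk//.
have mf : measurable_fun `[a, b]%classic f.
  by apply/measurable_EFinP; exact: measurable_int (fi a b).
have mr S' : measurable S' -> measurable_fun `[a, b]%classic (fun x => ((f \_ S') x)%:E).
  move=> mS'; apply/measurable_EFinP.
  by apply/(measurable_restrict _ mS') => //; exact: measurable_funS mf.
apply: (@dominated_cvg _ _ _ mu `[a, b]%classic _ (fun n x => ((f \_ (S n)) x)%:E)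
  (fun x => ((f \_ S0) x)%:E) (fun x => (`|f x|)%:E)) => //=.
- by move=> n; apply: mr.
- move=> x _; apply: cvg_near_cst; near=> n; rewrite /patch.
  have h : S n x <-> S0 x by near: n; exact: cv.
  by congr (_%:E); congr (if _ then _ else _); apply/idP/idP; rewrite !inE => /h.
- by apply: (loc_integrable_norm fi).
- by move=> n x _; rewrite lee_fin /patch; case: ifP => _ //; rewrite normr0.
Unshelve. all: by end_near.
Qed.

Lemma int_split_oc f a c b : loc_integrable f -> a <= c -> c <= b ->
  \int[mu]_(x in `[a, b]) f x = \int[mu]_(x in `[a, c]) f x + \int[mu]_(x in `]c, b]) f x.
Proof.
move=> fi ac cb; rewrite (@itv_bndbnd_setU _ _ _ (BRight c)) ?bnd_simp//.
rewrite (int_U (a := a) (b := b))//.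
- by apply: subset_itvl; rewrite bnd_simp.
- by apply: subset_itvr; rewrite bnd_simp.
- by move=> x /=; rewrite !in_itv/= => /andP[_ xc] /andP[]; rewrite ltNge xc.
Qed.

Lemma int_split_co f a c b : loc_integrable f -> a <= c -> c <= b ->
  \int[mu]_(x in `[a, b]) f x = \int[mu]_(x in `[a, c[) f x + \int[mu]_(x in `[c, b]) f x.
Proof.
move=> fi ac cb; rewrite (@itv_bndbnd_setU _ _ _ (BLeft c)) ?bnd_simp//.
rewrite (int_U (a := a) (b := b))//.
- by apply: subset_itvl; rewrite bnd_simp.
- by apply: subset_itvr; rewrite bnd_simp.
- by move=> x /=; rewrite !in_itv/= => /andP[_ xc] /andP[]; rewrite leNgt xc.
Qed.

(** The segment around [S] matters because [fine] sends an infinite mass to 0. *)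
Lemma fine_mu_gt0 S a b : measurable S -> S `<=` `[a, b] -> (0 < mu S)%E -> 0 < fine (mu S).
Proof.
move=> mS Sab mu0; apply: fine_gt0; rewrite mu0/=; apply: le_lt_trans (mu_fin a b).
by apply: le_measure => //; rewrite inE.
Qed.

Lemma fine_mu_le S S' a b : measurable S -> measurable S' -> S `<=` S' -> S' `<=` `[a, b] ->
  fine (mu S) <= fine (mu S').
Proof.
move=> mS mS' SS' S'ab.
have fin A : measurable A -> A `<=` `[a, b] -> mu A \is a fin_num.
  move=> mA Aab; rewrite ge0_fin_numE//; apply: le_lt_trans (mu_fin a b).
  by apply: le_measure => //; rewrite inE.
apply: fine_le; [apply: fin => //; exact: subset_trans S'ab|exact: fin|].
by apply: le_measure => //; rewrite inE.
Qed.

End local_integrals.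

(** * Clusters *)

(* [al t y] and [be t y] are the ends of the cluster that contains at time t the
   particle started at y.  The barycentre inequalities are multiplied by the mass,
   so that they also hold on null sets and are invariant under reflection. *)
Record sticky_core (R : realType) (mu : {measure set (measurableTypeR R) -> \bar R})
    (u : R -> R) (phi al be : R -> R -> R) : Prop := {
  core_fin : forall a b : R, (mu `[a, b]%classic < +oo)%E ;
  core_pos : forall a b : R, a < b -> (0 < mu `]a, b[%classic)%E ;
  core_int : loc_integrable mu u ;
  core_id : forall y, phi 0 y = y ;
  core_mono : forall t, 0 <= t -> {homo phi t : x y / x <= y} ;
  core_cluster : forall t y z, 0 <= t ->
    phi t z = phi t y <-> al t y <= z <= be t y ;
  core_nest : forall s t y z, 0 <= s -> s <= t -> phi s y = phi s z ->
    phi t y = phi t z ;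
  core_al : forall s t y, 0 <= s -> s <= t ->
    phi s (al t y) = al t y + s * u (al t y) ;
  core_be : forall s t y, 0 <= s -> s <= t ->
    phi s (be t y) = be t y + s * u (be t y) ;
  core_lower : forall t y z, 0 <= t -> al t y <= z <= be t y ->
    0 <= \int[mu]_(x in `[al t y, z]) (x + t * u x - phi t y) ;
  core_upper : forall t y z, 0 <= t -> al t y <= z <= be t y ->
    \int[mu]_(x in `[z, be t y]) (x + t * u x - phi t y) <= 0 }.

Section clusters.
Context {R : realType} (mu : {measure set (measurableTypeR R) -> \bar R}).
Variables (u : R -> R) (phi al be : R -> R -> R).
Hypothesis H : sticky_core mu u phi al be.
Let fin := core_fin H.
Let ui := core_int H.

Lemma core_drift t c : loc_integrable mu (fun x => x + t * u x - c).
Proof.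
apply: loc_integrableB; last exact: loc_integrable_cst.
by apply: loc_integrableD; [exact: loc_integrable_id|exact: loc_integrableZ].
Qed.

Lemma core_phi_int t : 0 <= t -> loc_integrable mu (phi t).
Proof. by move=> t0; apply: loc_integrable_nd => //; exact: (core_mono H). Qed.

Lemma core_driftphi t : 0 <= t -> loc_integrable mu (fun x => x + t * u x - phi t x).
Proof.
move=> t0; apply: loc_integrableB; last exact: core_phi_int.
by apply: loc_integrableD; [exact: loc_integrable_id|exact: loc_integrableZ].
Qed.

Lemma albe_in t y : 0 <= t -> al t y <= y <= be t y.
Proof. by move=> t0; apply/(core_cluster H _ _ t0). Qed.

Lemma al_le t y : 0 <= t -> al t y <= y.
Proof. by move=> /(albe_in y)/andP[]. Qed.

Lemma be_ge t y : 0 <= t -> y <= be t y.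
Proof. by move=> /(albe_in y)/andP[]. Qed.

Lemma al_le_be t y : 0 <= t -> al t y <= be t y.
Proof. by move=> t0; apply: le_trans (al_le y t0) (be_ge y t0). Qed.

Lemma phi_al t y : 0 <= t -> phi t (al t y) = phi t y.
Proof. by move=> t0; apply/(core_cluster H _ _ t0); rewrite lexx al_le_be. Qed.

Lemma phi_be t y : 0 <= t -> phi t (be t y) = phi t y.
Proof. by move=> t0; apply/(core_cluster H _ _ t0); rewrite lexx al_le_be. Qed.

Lemma cluster_eq t y z : 0 <= t -> phi t z = phi t y -> al t z = al t y /\ be t z = be t y.
Proof.
move=> t0 e; have /andP[h1 h2] : al t y <= al t z <= be t y.
  by apply/(core_cluster H _ _ t0); rewrite phi_al.
have /andP[h3 h4] : al t y <= be t z <= be t y.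
  by apply/(core_cluster H _ _ t0); rewrite phi_be.
have /andP[h5 h6] : al t z <= al t y <= be t z.
  by apply/(core_cluster H _ _ t0); rewrite phi_al.
have /andP[h7 h8] : al t z <= be t y <= be t z.
  by apply/(core_cluster H _ _ t0); rewrite phi_be.
by split; lra.
Qed.

Lemma al_al t y : 0 <= t -> al t (al t y) = al t y.
Proof. by move=> t0; have [] := cluster_eq t0 (phi_al y t0). Qed.

Lemma be_be t y : 0 <= t -> be t (be t y) = be t y.
Proof. by move=> t0; have [] := cluster_eq t0 (phi_be y t0). Qed.

Lemma nest_in s t y z : 0 <= s -> s <= t -> al s y <= z <= be s y -> al t y <= z <= be t y.
Proof.
move=> s0 st /(core_cluster H _ _ s0) e; apply/(core_cluster H); first exact: (le_trans s0).
exact: (core_nest H _ st e).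
Qed.

Lemma al_nest s t y : 0 <= s -> s <= t -> al t y <= al s y.
Proof.
by move=> s0 st; have := @nest_in s t y (al s y) s0 st; rewrite lexx al_le_be// => /(_ isT)/andP[].
Qed.

Lemma be_nest s t y : 0 <= s -> s <= t -> be s y <= be t y.
Proof.
by move=> s0 st; have := @nest_in s t y (be s y) s0 st; rewrite lexx al_le_be// => /(_ isT)/andP[].
Qed.

Lemma al0 y : al 0 y = y.
Proof. by have := phi_al y (lexx 0); rewrite !(core_id H). Qed.

Lemma be0 y : be 0 y = y.
Proof. by have := phi_be y (lexx 0); rewrite !(core_id H). Qed.

Lemma al_fix_nest s t c : 0 <= s -> s <= t -> al t c = c -> al s c = c.
Proof.
move=> s0 st e; apply/le_anti; rewrite al_le//=.
by rewrite -{1}e; apply: al_nest.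
Qed.

Lemma be_fix_nest s t c : 0 <= s -> s <= t -> be t c = c -> be s c = c.
Proof.
move=> s0 st e; apply/le_anti; rewrite be_ge//= andbT.
by rewrite -{2}e; apply: be_nest.
Qed.

(** Taken over the whole cluster, the two barycentre inequalities bound the same integral from
    opposite sides. *)
Lemma cluster_total t y : 0 <= t ->
  \int[mu]_(x in `[al t y, be t y]) (x + t * u x - phi t y) = 0.
Proof.
move=> t0; apply/le_anti; rewrite (core_upper H) ?lexx ?al_le_be//=.
by rewrite (core_lower H) ?lexx ?al_le_be.
Qed.

Lemma mu_itv_gt0 a b : a < b -> 0 < fine (mu `[a, b]%classic).
Proof.
move=> ab; apply: (fine_mu_gt0 fin (a := a) (b := b)) => //.
apply: lt_le_trans (core_pos H ab) _; apply: le_measure; rewrite ?inE//.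
exact: subset_itv_oo_cc.
Qed.

Lemma int_gt0 a b : a < b -> 0 < \int[mu]_(x in `[a, b]) (x - a).
Proof.
move=> ab; pose m := (a + b) / 2.
have am : a < m by rewrite /m; lra.
have mb : m < b by rewrite /m; lra.
have gi : loc_integrable mu (fun x => x - a).
  by apply: loc_integrableB => //; [exact: loc_integrable_id|exact: loc_integrable_cst].
rewrite (int_split_co gi (ltW am) (ltW mb)).
have h1 : 0 <= \int[mu]_(x in `[a, m[) (x - a).
  by apply: Rintegral_ge0 => x /=; rewrite in_itv/= => /andP[]; lra.
have h2 : (m - a) * fine (mu `[m, b]%classic) <= \int[mu]_(x in `[m, b]) (x - a).
  rewrite -Rintegral_cst//; apply: (int_le (a := m) (b := b)) => //.
    exact: loc_integrable_cst.
  by move=> x /=; rewrite in_itv/= => /andP[]; lra.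
have : 0 < (m - a) * fine (mu `[m, b]%classic) by rewrite mulr_gt0 ?mu_itv_gt0//; lra.
lra.
Qed.

(* With f(r) the integral of (x + r u(x)) - (c + r u(c)) over the cluster that
   starts at c at time s, f is affine, f(0) > 0 = f(s) and f(t) >= 0. *)
Lemma al_isolated s t c : 0 <= s -> s < t -> al t c = c -> be s c = c.
Proof.
move=> s0 st alc; have t0 : 0 <= t by lra.
have alsc := al_fix_nest s0 (ltW st) alc.
apply/le_anti; rewrite be_ge//= andbT leNgt; apply/negP; set b := be s c => cb.
have f_affine r : \int[mu]_(x in `[c, b]) (x + r * u x - (c + r * u c)) =
    \int[mu]_(x in `[c, b]) (x - c) + r * \int[mu]_(x in `[c, b]) (u x - u c).
  have i1 : loc_integrable mu (fun x => x - c).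
    by apply: loc_integrableB => //; [exact: loc_integrable_id|exact: loc_integrable_cst].
  have i2 : loc_integrable mu (fun x => u x - u c).
    by apply: loc_integrableB => //; exact: loc_integrable_cst.
  rewrite -(int_Z (a := c) (b := b))// -(int_D (a := c) (b := b))//; last exact: loc_integrableZ.
  by apply: eq_Rintegral => x _; lra.
have := cluster_total c s0; rewrite alsc -/b.
have -> : phi s c = c + s * u c by have := core_al H c s0 (ltW st); rewrite alc.
have := @core_lower _ _ _ _ _ _ H t c b t0; rewrite alc (be_nest c s0 (ltW st)) ltW//= => /(_ isT).
have -> : phi t c = c + t * u c by have := core_al H c t0 (lexx t); rewrite alc.
rewrite !f_affine; have := int_gt0 cb; set p := \int[mu]_(x in _) _; set k := \int[mu]_(x in _) _.
nra.
Qed.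

End clusters.

(** * Intervals made of whole clusters *)

Section saturation.
Context {R : realType} (mu : {measure set (measurableTypeR R) -> \bar R}).
Variables (u : R -> R) (phi al be : R -> R -> R).
Hypothesis H : sticky_core mu u phi al be.
Let fin := core_fin H.
Let ui := core_int H.

Lemma al_mono t y z : 0 <= t -> y <= z -> al t y <= al t z.
Proof.
move=> t0 yz; rewrite leNgt; apply/negP => lt.
have h1 := core_mono H t0 (ltW lt); have h2 := core_mono H t0 yz.
rewrite !(phi_al H) // in h1.
have [e _] := cluster_eq H t0 (le_anti (introT andP (conj h1 h2))).
by rewrite e ltxx in lt.
Qed.

Lemma be_mono t y z : 0 <= t -> y <= z -> be t y <= be t z.
Proof.
move=> t0 yz; rewrite leNgt; apply/negP => lt.
have h1 := core_mono H t0 (ltW lt); have h2 := core_mono H t0 yz.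
rewrite !(phi_be H) // in h1.
have [_ e] := cluster_eq H t0 (le_anti (introT andP (conj h1 h2))).
by rewrite e ltxx in lt.
Qed.

Lemma cluster_total_phi t y : 0 <= t ->
  \int[mu]_(x in `[al t y, be t y]) (x + t * u x - phi t x) = 0.
Proof.
move=> t0; rewrite -[RHS](cluster_total H y t0); apply: eq_Rintegral => x.
by rewrite inE/= in_itv/= => /(core_cluster H _ _ t0) ->.
Qed.

(* Only countably many clusters are non-degenerate; off them phi is free. *)
Lemma saturated_total t c d : 0 <= t -> al t c = c -> be t d = d ->
  \int[mu]_(x in `[c, d]) (x + t * u x - phi t x) = 0.
Proof.
move=> t0 alc bed; set g := fun x => x + t * u x - phi t x.
have gi : loc_integrable mu g by exact: (core_driftphi H t0).
have sub q : c <= q <= d -> `[al t q, be t q] `<=` `[c, d].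
  move=> /andP[cq qd]; apply: subset_itv; rewrite bnd_simp.
    by rewrite -alc al_mono.
  by rewrite -bed be_mono.
(* Every non-degenerate cluster contains a rational, so the clusters of the rationals of [[c, d]]
   include all of them, possibly with repetitions. *)
pose F n := if unpickle n is Some q then
    if c <= ratr q <= d then `[al t (ratr q), be t (ratr q)]%classic else set0
  else set0 : set R.
have mF n : measurable (F n : set (measurableTypeR R)).
  by rewrite /F; case: (unpickle n) => // q; case: ifP.
have Fsub n : F n `<=` `[c, d].
  by rewrite /F; case: (unpickle n) => [q|]; [case: ifP => [/sub//|_]|]; exact: sub0set.
have Fint n : \int[mu]_(x in F n) g x = 0.
  rewrite /F; case: (unpickle n) => [q|]; last by rewrite Rintegral_set0.
  by case: ifP => _; [exact: cluster_total_phi|rewrite Rintegral_set0].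
have Feq m n x : F m x -> F n x -> F m = F n.
  rewrite /F; case: (unpickle m) => // p; case: ifP => // _.
  case: (unpickle n) => // q; case: ifP => // _ /=.
  rewrite !in_itv/= => /(core_cluster H _ _ t0) e1 /(core_cluster H _ _ t0) e2.
  by have [-> ->] := cluster_eq H t0 (etrans (esym e1) e2).
(* Two listed clusters coincide or are disjoint, so removing the earlier ones leaves a cluster whole
   or empties it, and countable additivity applies. *)
have seqE n : seqDU F n = F n \/ seqDU F n = set0.
  case: (pselect (exists k, [/\ (k < n)%N & F k `&` F n !=set0])) => [[k [kn [x [Fk Fn]]]]|no].
    right; rewrite -subset0 => z []; rewrite -(Feq _ _ _ Fk Fn) => Fkz; apply.
    by rewrite -bigcup_mkord; exists k.
  left; apply/seteqP; split=> [z []//|z Fz]; split => //.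
  rewrite -bigcup_mkord => -[k /= kn Fkz]; apply: no; exists k; split => //.
  by exists z.
have mD : measurable (\bigcup_n F n : set (measurableTypeR R)) by exact: bigcup_measurable.
have Dsub : \bigcup_n F n `<=` `[c, d] by move=> x [n _ /Fsub].
have D0 : \int[mu]_(x in \bigcup_n F n) g x = 0.
  rewrite /Rintegral seqDU_bigcup_eq integral_bigcup//.
  - rewrite eseries0//= => n _ _.
    have [->|->] := seqE n; last by rewrite integral_set0.
    rewrite -[LHS]fineK; first by rewrite [fine _](Fint n).
    by apply: integrable_fin_num => //; exact: (loc_integrableS gi (mF n) (Fsub n)).
  - by move=> n; apply: measurableD => //; exact: bigsetU_measurable.
  - rewrite -seqDU_bigcup_eq.
    exact: (loc_integrableS gi mD Dsub).
(* A point off the union is its own cluster, so it has moved freely and the integrand vanishes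
   there. *)
rewrite -(setDUK Dsub) (int_U (a := c) (b := d))//.
- rewrite D0 add0r -[RHS](Rintegral_set0 mu g).
  rewrite (@eq_Rintegral _ _ _ _ _ (fun=> 0)).
    by rewrite Rintegral_cst ?mul0r ?Rintegral_set0//; exact: measurableD.
  move=> x; rewrite inE => -[/= xcd xD]; rewrite /g.
  have := al_le_be H x t0; rewrite le_eqVlt => /orP[/eqP e|lt].
    have xe : x = al t x by have /andP[] := albe_in H x t0; rewrite -e; lra.
    by have := core_al H x t0 (lexx t); rewrite -xe => ->; rewrite subrr.
  have [q] := rat_in_itvoo lt; rewrite in_itv/= => /andP[q1 q2]; exfalso; apply: xD.
  have e : phi t (ratr q) = phi t x by apply/(core_cluster H _ _ t0); rewrite !ltW.
  have [e1 e2] := cluster_eq H t0 e.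
  exists (pickle q); [exact: I|rewrite /F pickleK].
  rewrite ifT.
    by rewrite e1 e2 /= in_itv/= (albe_in H).
  have /(sub x) : c <= x <= d by rewrite in_itv/= in xcd.
  move=> /(_ (ratr q)); rewrite /= !in_itv/=; apply.
  by rewrite !ltW.
- exact: measurableD.
- by move=> x Dx [_ /(_ Dx)].
Qed.

(** The part [[c, al t z[] consists of whole clusters and contributes 0, so only the initial piece
    [[al t z, z]] of the last cluster counts. *)
Lemma saturated_lower t c z : 0 <= t -> al t c = c -> c <= z ->
  0 <= \int[mu]_(x in `[c, z]) (x + t * u x - phi t x).
Proof.
move=> t0 alc cz; set g := fun x => x + t * u x - phi t x.
have gi : loc_integrable mu g by exact: (core_driftphi H t0).
have caz : c <= al t z by rewrite -alc al_mono.
have azb := al_le_be H z t0; have az := al_le H z t0.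
have := int_split_co gi caz azb.
rewrite /g saturated_total ?(be_be H) ?cluster_total_phi// addr0 -/g => e.
rewrite (int_split_co gi caz az) -e add0r.
have -> : \int[mu]_(x in `[al t z, z]) g x =
    \int[mu]_(x in `[al t z, z]) (x + t * u x - phi t z); last first.
  by apply: (core_lower H) => //; rewrite az (be_ge H).
apply: eq_Rintegral => x; rewrite inE/= in_itv/= => /andP[h1 h2]; rewrite /g; congr (_ - _).
by apply/(core_cluster H _ _ t0); rewrite h1 (le_trans h2)// (be_ge H).
Qed.

(* The mass of [al (t + h) y, z] has its free barycentre left of phi t z at time t,
   and right of phi (t + h) y at time t + h. *)
Lemma front_upper t h y z : 0 <= t -> 0 < h -> be t z = z ->
  al (t + h) y <= z <= be (t + h) y ->
  (phi (t + h) y - phi t z) * fine (mu `[al (t + h) y, z]%classic) <=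
  h * \int[mu]_(x in `[al (t + h) y, z]) u x.
Proof.
move=> t0 h0 bez yz; set a := al (t + h) y; set k := _ - _.
have th0 : 0 <= t + h by lra.
have tth : t <= t + h by lra.
have ala : al t a = a by apply: (al_fix_nest H t0 tth); rewrite (al_al H).
have az : a <= z by case/andP : yz.
have gi := core_driftphi H t0.
have hi : loc_integrable mu (fun x => h * u x) by exact: loc_integrableZ.
have hki : loc_integrable mu (fun x => h * u x - k).
  by apply: loc_integrableB => //; exact: loc_integrable_cst.
(* The inequality [core_lower] at time [t + h], in which [phi t z] is replaced by the smaller
   [phi t x] for [x <= z]. The first summand then integrates to 0 over whole clusters. *)
have : 0 <= \int[mu]_(x in `[a, z]) ((x + t * u x - phi t x) + (h * u x - k)).
  apply: le_trans (core_lower H th0 yz) _.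
  apply: (int_le (a := a) (b := z)) => //; first exact: (core_drift H).
    exact: loc_integrableD.
  move=> x /=; rewrite in_itv/= => /andP[_ /(core_mono H t0)]; rewrite /k; lra.
rewrite (int_D (a := a) (b := z))// saturated_total// add0r.
rewrite (int_B (a := a) (b := z))//; last exact: loc_integrable_cst.
by rewrite (int_Z (a := a) (b := z))// Rintegral_cst//; lra.
Qed.

End saturation.

(** * Reflection *)

(* x |-> - x exchanges left and right, so that one-sided estimates need only be
   proved once. *)
Section reflection.
Context {R : realType} (mu : {measure set (measurableTypeR R) -> \bar R}).

Let measurable_opp :
  measurable_fun [set: measurableTypeR R] (-%R : measurableTypeR R -> measurableTypeR R).
Proof. exact: oppr_measurable. Qed.

Definition reflected : {measure set (measurableTypeR R) -> \bar R} :=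
  measure_function_pushforward__canonical__measure_function_Measure mu measurable_opp.

Lemma opp_itvcc (a b : R) : -%R @^-1` `[a, b] = `[- b, - a]%classic.
Proof. by apply/seteqP; split=> x /=; rewrite !in_itv/= lerNr lerNl andbC. Qed.

Lemma opp_itvoo (a b : R) : -%R @^-1` `]a, b[ = `]- b, - a[%classic.
Proof. by apply/seteqP; split=> x /=; rewrite !in_itv/= ltrNr ltrNl andbC. Qed.

Lemma reflectedE (S : set R) : reflected S = mu (-%R @^-1` S).
Proof. by []. Qed.

Section fixed.
Variables (f : R -> R) (a b : R).
Hypothesis fi : loc_integrable mu f.
(** The truncation makes the function measurable on the whole line, as the change of variables for a
    pushforward requires. *)
Let F := ((fun x => f (- x)) \_ `[a, b]).

Let mF : measurable_fun [set: measurableTypeR R] (EFin \o F).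
Proof.
have -> : EFin \o F = (EFin \o (f \_ `[- b, - a])) \o -%R.
  apply/funext => x /=; rewrite /F !patchE !mem_setE !in_itv/= lerN2 lerN2.
  by rewrite andbC.
apply: measurableT_comp => //; apply/measurable_EFinP.
apply/(measurable_restrict (E := setT)) => //.
rewrite setTI; apply/measurable_EFinP; exact: measurable_int (fi _ _).
Qed.

Let Fi : mu.-integrable (-%R @^-1` `[a, b]) ((EFin \o F) \o -%R).
Proof.
rewrite opp_itvcc; apply: eq_integrable (fi (- b) (- a)) => // x.
rewrite inE/= in_itv/= => xba; rewrite /F patchE opprK ifT// inE/= in_itv/=.
by move: xba => /andP[? ?]; apply/andP; split; lra.
Qed.

Lemma integrable_reflected : reflected.-integrable `[a, b] (EFin \o (fun x => f (- x))).
Proof.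
apply: eq_integrable (integrable_pushforward measurable_opp mF Fi _) => // x xab.
by rewrite /= /F patchE xab.
Qed.

Lemma Rintegral_reflected :
  \int[reflected]_(x in `[a, b]) f (- x) = \int[mu]_(x in `[- b, - a]) f x.
Proof.
rewrite /Rintegral; congr fine.
transitivity (\int[reflected]_(x in `[a, b]) (EFin \o F) x)%E.
  by apply: eq_integral => x xab; rewrite /= /F patchE xab.
rewrite (integral_pushforward measurable_opp mF Fi)// opp_itvcc.
apply: eq_integral => x; rewrite inE/= in_itv/= => /andP[? ?].
by rewrite /F patchE opprK ifT// inE/= in_itv/=; apply/andP; split; lra.
Qed.

End fixed.

Lemma Rintegral_reflectedN f a b : loc_integrable mu f ->
  \int[reflected]_(x in `[a, b]) (- f (- x)) = - \int[mu]_(x in `[- b, - a]) f x.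
Proof.
move=> fi; have := Rintegral_reflected a b (loc_integrableZ (-1) fi).
rewrite (int_Z (mu := mu) (a := - b) (b := - a))// mulN1r => <-.
by apply: eq_Rintegral => x _; rewrite mulN1r.
Qed.

Variables (u : R -> R) (phi al be : R -> R -> R).

(** Positions and velocities change sign, the two cluster ends exchange roles, and so do
    [core_lower] and [core_upper]. *)
Lemma core_reflected : sticky_core mu u phi al be ->
  sticky_core reflected (fun x => - u (- x)) (fun t y => - phi t (- y))
    (fun t y => - be t (- y)) (fun t y => - al t (- y)).
Proof.
move=> H; have ui := core_int H.
have E t y a b : \int[reflected]_(x in `[a, b]) (x + t * - u (- x) - - phi t (- y)) =
   - \int[mu]_(x in `[- b, - a]) (x + t * u x - phi t (- y)).
  have gi := core_drift H t (phi t (- y)).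
  rewrite -(Rintegral_reflectedN a b gi).
  by apply: eq_Rintegral => x _; lra.
split.
- by move=> a b; rewrite reflectedE opp_itvcc (core_fin H).
- by move=> a b ab; rewrite reflectedE opp_itvoo (core_pos H)// ltrN2.
- have nui : loc_integrable mu (fun x => - 1 * u x) by exact: loc_integrableZ.
  move=> a b; apply: eq_integrable (integrable_reflected a b nui) => // x _ /=.
  by rewrite mulN1r.
- by move=> y; rewrite (core_id H) opprK.
- by move=> t t0 x y xy; rewrite lerN2 (core_mono H)// lerN2.
- move=> t y z t0; have := core_cluster H (- y) (- z) t0; rewrite andbC lerNl lerNr => <-.
  by split=> [/oppr_inj//|->].
- by move=> s t y z s0 st /oppr_inj e; congr -%R; exact: (core_nest H s0 st e).
- by move=> s t y s0 st; rewrite opprK (core_be H)//; lra.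
- by move=> s t y s0 st; rewrite opprK (core_al H)//; lra.
- move=> t y z t0 /andP[h1 h2]; rewrite E opprK oppr_ge0; apply: (core_upper H) => //.
  by apply/andP; split; lra.
- move=> t y z t0 /andP[h1 h2]; rewrite E opprK oppr_le0; apply: (core_lower H) => //.
  by apply/andP; split; lra.
Qed.

End reflection.

Section reflected_estimates.
Context {R : realType} (mu : {measure set (measurableTypeR R) -> \bar R}).
Variables (u : R -> R) (phi al be : R -> R -> R).
Hypothesis H : sticky_core mu u phi al be.

Lemma be_isolated s t c : 0 <= s -> s < t -> be t c = c -> al s c = c.
Proof.
move=> s0 st bec; have := al_isolated (core_reflected H) s0 st (c := - c).
by rewrite !opprK bec => /(_ erefl)/oppr_inj.
Qed.

Lemma saturated_upper t z d : 0 <= t -> be t d = d -> z <= d ->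
  \int[mu]_(x in `[z, d]) (x + t * u x - phi t x) <= 0.
Proof.
move=> t0 bed zd; have := saturated_lower (core_reflected H) t0 (c := - d) (z := - z).
rewrite !opprK bed lerN2 => /(_ erefl zd).
have gi := core_driftphi H t0.
rewrite (_ : \int[_]_(x in _) _ = - \int[mu]_(x in `[z, d]) (x + t * u x - phi t x)); first lra.
rewrite -[in RHS](opprK z) -[in RHS](opprK d) -(Rintegral_reflectedN _ _ gi).
by apply: eq_Rintegral => x _; lra.
Qed.

Lemma front_lower t h y z : 0 <= t -> 0 < h -> al t z = z ->
  al (t + h) y <= z <= be (t + h) y ->
  h * \int[mu]_(x in `[z, be (t + h) y]) u x <=
  (phi (t + h) y - phi t z) * fine (mu `[z, be (t + h) y]%classic).
Proof.
move=> t0 h0 alz /andP[h1 h2].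
have := front_upper (core_reflected H) t0 h0 (y := - y) (z := - z).
rewrite !opprK alz !lerN2 h1 h2 => /(_ erefl isT).
rewrite reflectedE opp_itvcc !opprK.
rewrite (_ : \int[_]_(x in _) _ = - \int[mu]_(x in `[z, be (t + h) y]) u x); first lra.
by rewrite -[in RHS](opprK z) -[in RHS](opprK (be _ _)) -(Rintegral_reflectedN _ _ (core_int H)).
Qed.

End reflected_estimates.

(** * Velocities at positive times *)

Section interval_limits.
Context {R : realType} (mu : {measure set (measurableTypeR R) -> \bar R}).

Lemma int_setD f (A B : set R) a b : loc_integrable mu f -> measurable A -> measurable B ->
  B `<=` A -> A `<=` `[a, b] ->
  \int[mu]_(x in A `\` B) f x = \int[mu]_(x in A) f x - \int[mu]_(x in B) f x.
Proof.
move=> fi mA mB BA Aab; rewrite -[in RHS](setDUK BA) (int_U (a := a) (b := b))//.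
- by rewrite addrC addKr.
- exact: measurableD.
- exact: subset_trans Aab.
- by move=> x [/Aab].
- by move=> x Bx [_ /(_ Bx)].
Qed.

(** The two integrals differ by at most the integral of [|f|] over a thin shell around [[a, b]], and
    the shells decrease to the empty set. Atoms at [a] and [b] do no harm because [[p h, q h]]
    contains [[a, b]]. *)
Lemma cvg_int_itv (F : set_system R) {FF : ProperFilter F} f (p q : R -> R) (a b : R) :
  loc_integrable mu f ->
  p h @[h --> F] --> a -> q h @[h --> F] --> b ->
  (\forall h \near F, p h <= a <= b /\ b <= q h) ->
  \int[mu]_(x in `[p h, q h]) f x @[h --> F] --> \int[mu]_(x in `[a, b]) f x.
Proof.
move=> fi pa qb pq; apply/cvgrPdist_lt => e e0.
pose S n := `[a - n.+1%:R^-1, b + n.+1%:R^-1] `\` `[a, b]%classic.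
have mS n : measurable (S n : set (measurableTypeR R)) by exact: measurableD.
have le1 n : n.+1%:R^-1 <= 1 :> R by rewrite invf_le1// ler1n.
have ge0 n : 0 <= n.+1%:R^-1 :> R by rewrite invr_ge0.
have Ssub n : S n `<=` `[a - 1, b + 1].
  move=> x [/=]; rewrite !in_itv/= => /andP[]; move: (n.+1%:R^-1) (le1 n) => r r1 h1 h2 _.
  by apply/andP; split; lra.
have : \int[mu]_(x in S n) `|f x| @[n --> \oo] --> \int[mu]_(x in set0) `|f x|.
  apply: (cvg_int (a := a - 1) (b := b + 1)) => //; first exact: loc_integrable_norm.
  move=> x; have [xab|xab] := boolP (a <= x <= b).
    by near=> n; split=> // -[_]; rewrite /= in_itv/= xab.
  have [d d0 hd] : exists2 d, 0 < d & (x < a - d) || (b + d < x).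
    rewrite negb_and -!ltNge in xab; case/orP: xab => h.
      by exists ((a - x) / 2); [|apply/orP; left]; lra.
    by exists ((x - b) / 2); [|apply/orP; right]; lra.
  near=> n; split=> // -[/=]; rewrite in_itv/= => /andP[h1 h2] _.
  have : n.+1%:R^-1 < d by near: n; exact: near_infty_natSinv_lt (PosNum d0).
  move: (n.+1%:R^-1) h1 h2 => r h1 h2 rd; by move: hd => /orP[]; lra.
rewrite Rintegral_set0 => /cvgrPdist_lt/(_ _ e0) [N _ /(_ N (leqnn N))] /=.
rewrite sub0r normrN => small.
have N0 : 0 < N.+1%:R^-1 :> R by rewrite invr_gt0.
move/cvgrPdist_lt: (pa) => /(_ _ N0) pN; move/cvgrPdist_lt: (qb) => /(_ _ N0) qN.
near=> h.
have [/andP[pa' ab] bq] : p h <= a <= b /\ b <= q h by near: h.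
have hp : `|a - p h| < N.+1%:R^-1 by near: h; exact: pN.
have hq : `|b - q h| < N.+1%:R^-1 by near: h; exact: qN.
rewrite distrC.
have absub : `[a, b] `<=` `[p h, q h] by apply: subset_itv; rewrite bnd_simp.
rewrite -(int_setD (a := p h) (b := q h))//.
have DS : `[p h, q h] `\` `[a, b] `<=` S N.
  apply: setSD => x /=; rewrite !in_itv/= => /andP[].
  move: (N.+1%:R^-1) hp hq => r hp hq h1 h2; move: hp hq; rewrite !ltr_norml => /andP[? ?] /andP[? ?].
  by apply/andP; split; lra.
have mD : measurable (`[p h, q h] `\` `[a, b] : set (measurableTypeR R)) by exact: measurableD.
apply: le_lt_trans (le_normr_Rintegral mD _) _.
  by apply: (loc_integrableS fi mD); exact: subset_trans (Ssub N).
apply: le_lt_trans small.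
have ni := loc_integrable_norm fi.
rewrite [leRHS]ger0_norm; last exact: Rintegral_ge0.
rewrite -subr_ge0 -(int_setD ni (mS N) mD DS (Ssub N)).
exact: Rintegral_ge0.
Unshelve. all: by end_near.
Qed.

End interval_limits.

(** * Clusters grow continuously from the right in time *)

Section short_times.
Context {R : realType} (mu : {measure set (measurableTypeR R) -> \bar R}).
Variables (u : R -> R) (phi al be : R -> R -> R).
Hypothesis H : sticky_core mu u phi al be.
Let fin := core_fin H.
Let ui := core_int H.

(* Otherwise the mass on either side of a gap ]z, w[ would have to cross it in
   arbitrarily short time, with bounded mean velocities. *)
Lemma al_shrink t y a' : 0 <= t -> a' < al t y ->
  exists2 h0, 0 < h0 & forall h, 0 < h -> h <= h0 -> a' < al (t + h) y.
Proof.
move=> t0 a'al; apply: contrapT => no.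
have al_le_a' h : 0 < h -> al (t + h) y <= a'.
  move=> h0; rewrite leNgt; apply/negP => lt; apply: no; exists h => // k k0 kh.
  by apply: lt_le_trans lt _; apply: (al_nest H); lra.
(* [z] is the right end of a cluster at time [t], strictly between [a'] and [al t y]. *)
pose z0 := (a' + al t y) / 2; pose z := be t z0.
have z0al : z0 < al t y by rewrite /z0; lra.
have a'z : a' < z by apply: lt_le_trans (be_ge H z0 t0); rewrite /z0; lra.
have phineq (v w : R) : be t v < w -> phi t v < phi t w.
  move=> vw; rewrite lt_neqAle (core_mono H)// ?andbT; last first.
    by apply: le_trans (ltW vw); exact: (be_ge H v t0).
  apply/eqP => e; have [_ ee] := cluster_eq H t0 e.
  by have := be_ge H w t0; rewrite -ee leNgt vw.
have zal : z < al t y.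
  rewrite ltNge; apply/negP => alz.
  have : phi t (al t y) = phi t z0.
    apply/(core_cluster H _ _ t0); rewrite alz andbT.
    by apply: le_trans (ltW z0al); exact: (al_le H z0 t0).
  move=> /(cluster_eq H t0)[]; rewrite (al_al H)// => e _.
  by have := al_le H z0 t0; rewrite -e leNgt z0al.
(* [w] is the left end of a cluster further right, so that a gap separates [phi t z] from
   [phi t w]. *)
pose w0 := (z + al t y) / 2; pose w := al t w0.
have zw0 : z < w0 by rewrite /w0; lra.
have w0al : w0 < al t y by rewrite /w0; lra.
have phizw : phi t z < phi t w.
  by rewrite (phi_be H)// (phi_al H)//; exact: phineq.
have zw : z < w.
  by rewrite ltNge; apply/negP => /(core_mono H t0); rewrite leNgt phizw.
have wy : w < y.
  apply: le_lt_trans (al_le H w0 t0) _; apply: lt_le_trans w0al _; exact: (al_le H y t0).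
(* For [h <= 1] the cluster of [y] at time [t + h] stays in [[c, d]], so [U] bounds all the momenta
   involved uniformly. *)
pose c := al (t + 1) y; pose d := be (t + 1) y.
pose U := \int[mu]_(x in `[c, d]) `|u x|.
have ni := loc_integrable_norm ui.
have bound (p q : R) : c <= p -> q <= d -> `|\int[mu]_(x in `[p, q]) u x| <= U.
  move=> cp qd; have sub : `[p, q] `<=` `[c, d] by apply: subset_itv; rewrite bnd_simp.
  apply: le_trans (le_normr_Rintegral _ (loc_integrableS ui _ sub)) _ => //.
  by rewrite -subr_ge0 -(int_setD (a := c) (b := d))//; exact: Rintegral_ge0.
have U0 : 0 <= U by exact: Rintegral_ge0.
pose m1 := fine (mu `[a', z]%classic); pose m2 := fine (mu `[w, y]%classic).
have m1p : 0 < m1 by exact: (mu_itv_gt0 H a'z).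
have m2p : 0 < m2 by exact: (mu_itv_gt0 H wy).
(* At time [t + h] both [z] and [w] have reached [phi (t + h) y]. The two front estimates bound the
   displacements on either side, with masses at least [m1] and [m2]. *)
have est h : 0 < h -> h <= 1 -> phi t w - phi t z <= h * (U / m1 + U / m2).
  move=> h0 h1; have th0 : 0 <= t + h by lra.
  have ah := al_le_a' h h0; have bh := be_ge H y th0.
  have ca : c <= al (t + h) y by apply: (al_nest H); lra.
  have bd : be (t + h) y <= d by apply: (be_nest H); lra.
  have azb : al (t + h) y <= z <= be (t + h) y by apply/andP; split; lra.
  have awb : al (t + h) y <= w <= be (t + h) y by apply/andP; split; lra.
  have E1 := front_upper H t0 h0 (be_be H z0 t0) azb.
  have E2 := front_lower H t0 h0 (al_al H w0 t0) awb.
  rewrite -/w -/z in E1 E2.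
  have zd : z <= d by lra.
  have cw : c <= w by lra.
  have := bound _ _ ca zd; have := bound _ _ cw bd; rewrite !ler_norml => /andP[b1 _] /andP[_ b2].
  have M1 : m1 <= fine (mu `[al (t + h) y, z]%classic).
    apply: (fine_mu_le fin (a := al (t + h) y) (b := z)) => //.
    by apply: subset_itv; rewrite bnd_simp.
  have M2 : m2 <= fine (mu `[w, be (t + h) y]%classic).
    apply: (fine_mu_le fin (a := w) (b := be (t + h) y)) => //.
    by apply: subset_itv; rewrite bnd_simp.
  have G1 : phi (t + h) y - phi t z <= h * (U / m1).
    rewrite mulrA ler_pdivlMr//.
    have [neg|pos] := leP (phi (t + h) y - phi t z) 0; first by nra.
    by move: E1 M1 b2; nra.
  have G2 : phi t w - phi (t + h) y <= h * (U / m2).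
    rewrite mulrA ler_pdivlMr//.
    have [neg|pos] := leP (phi t w - phi (t + h) y) 0; first by nra.
    by move: E2 M2 b1; nra.
  by rewrite mulrDr; lra.
pose K := U / m1 + U / m2.
have K0 : 0 <= K by rewrite addr_ge0// divr_ge0// ltW.
pose e := phi t w - phi t z.
have e0 : 0 < e by rewrite subr_gt0.
have K1 : 0 < K + 1 by lra.
have Ke : 0 < K + 1 + e by lra.
(* This time is at most 1 and its product with [K] is less than [e], which contradicts [est]. *)
have q0 : 0 < e / (K + 1 + e) by rewrite divr_gt0.
have q1 : e / (K + 1 + e) <= 1 by rewrite ler_pdivrMr//; lra.
have := est _ q0 q1; rewrite -/K -/e mulrAC ler_pdivlMr//; nra.
Qed.

End short_times.

(** * Right derivatives on non-degenerate clusters *)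

Section cluster_velocity.
Context {R : realType} (mu : {measure set (measurableTypeR R) -> \bar R}).
Variables (u : R -> R) (phi al be : R -> R -> R).
Hypothesis H : sticky_core mu u phi al be.
Let fin := core_fin H.
Let ui := core_int H.

Lemma be_shrink t y b' : 0 <= t -> be t y < b' ->
  exists2 h0, 0 < h0 & forall h, 0 < h -> h <= h0 -> be (t + h) y < b'.
Proof.
move=> t0 bb'; have := al_shrink (core_reflected H) (y := - y) (a' := - b') t0.
rewrite opprK ltrN2 => /(_ bb')[h0 h00 hh]; exists h0 => // h hp hh0.
by have := hh h hp hh0; rewrite ltrN2.
Qed.

Lemma cvg_al t y : 0 <= t -> al (t + h) y @[h --> 0^'+] --> al t y.
Proof.
move=> t0; apply/cvgrPdist_lt => e e0.
have [|h0 h00 hh] := al_shrink H (y := y) (a' := al t y - e) t0; first lra.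
near=> h.
have hp : 0 < h by [].
have h1 : h <= h0 by near: h; exact: nbhs_right_le.
have := hh _ hp h1; have : al (t + h) y <= al t y by apply: (al_nest H); lra.
by move=> ? ?; rewrite ger0_norm; lra.
Unshelve. all: by end_near.
Qed.

Lemma cvg_be t y : 0 <= t -> be (t + h) y @[h --> 0^'+] --> be t y.
Proof.
move=> t0; apply/cvgrPdist_lt => e e0.
have [|h0 h00 hh] := be_shrink (y := y) (b' := be t y + e) t0; first lra.
near=> h.
have hp : 0 < h by [].
have h1 : h <= h0 by near: h; exact: nbhs_right_le.
have := hh _ hp h1; have : be t y <= be (t + h) y by apply: (be_nest H); lra.
by move=> ? ?; rewrite ler0_norm; lra.
Unshelve. all: by end_near.
Qed.

Lemma cvg_average_itv (p q : R -> R) (a b : R) : a < b ->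
  p h @[h --> 0^'+] --> a -> q h @[h --> 0^'+] --> b ->
  (\forall h \near 0^'+, p h <= a <= b /\ b <= q h) ->
  average mu `[p h, q h] u @[h --> 0^'+] --> average mu `[a, b] u.
Proof.
move=> ab pa qb pq; apply: cvgM; last exact: cvg_int_itv.
(* Mass is the integral of 1, so [cvg_int_itv] also handles the denominator. *)
have muE (c d : R) : fine (mu `[c, d]%classic) = \int[mu]_(x in `[c, d]) 1.
  by rewrite Rintegral_cst// mul1r.
apply: cvgV; first by rewrite gt_eqF//; exact: (mu_itv_gt0 H).
rewrite muE; under eq_fun do rewrite muE.
by apply: cvg_int_itv => //; exact: loc_integrable_cst.
Qed.

(** The difference quotient lies between the means of [u] over [[al t y, be (t + h) y]] and
    [[al (t + h) y, be t y]], by [front_lower] at [al t y] and [front_upper] at [be t y]. Both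
    intervals shrink to the cluster. *)
Lemma cluster_derivative t y : 0 <= t -> al t y < be t y ->
  is_right_derivative (fun r => phi r y) t (average mu `[al t y, be t y] u).
Proof.
move=> t0 lt; rewrite /is_right_derivative.
have cal := @cvg_al _ y t0; have cbe := @cvg_be _ y t0.
have upper := @cvg_average_itv (fun h => al (t + h) y) (fun=> be t y) _ _ lt cal (cvg_cst _).
have lower := @cvg_average_itv (fun=> al t y) (fun h => be (t + h) y) _ _ lt (cvg_cst _) cbe.
apply: (squeeze_cvgr _ (lower _ _) (upper _ _)).
- near=> h.
  have h0 : 0 < h by [].
  have th0 : 0 <= t + h by lra.
  have aa : al (t + h) y <= al t y by apply: (al_nest H); lra.
  have bb : be t y <= be (t + h) y by apply: (be_nest H); lra.
  have azb : al (t + h) y <= be t y <= be (t + h) y by apply/andP; split; lra.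
  have awb : al (t + h) y <= al t y <= be (t + h) y by apply/andP; split; lra.
  have := front_upper H t0 h0 (be_be H y t0) azb; rewrite (phi_be H)//.
  have := front_lower H t0 h0 (al_al H y t0) awb; rewrite (phi_al H)//.
  rewrite /average => E1 E2; apply/andP; split.
    rewrite ler_pdivrMl; last by apply: (mu_itv_gt0 H); lra.
    by rewrite mulrCA ler_pdivlMl// [leRHS]mulrC.
  rewrite ler_pdivrMl// mulrCA ler_pdivlMl; last by apply: (mu_itv_gt0 H); lra.
  by rewrite mulrC.
- near=> h.
  have h0 : 0 < h by [].
  have aa : al (t + h) y <= al t y by apply: (al_nest H); lra.
  have bb : be t y <= be (t + h) y by apply: (be_nest H); lra.
  by split; [apply/andP; split|]; lra.
- near=> h.
  have h0 : 0 < h by [].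
  have aa : al (t + h) y <= al t y by apply: (al_nest H); lra.
  have bb : be t y <= be (t + h) y by apply: (be_nest H); lra.
  by split; [apply/andP; split|]; lra.
Unshelve. all: by end_near.
Qed.

End cluster_velocity.

(** * Particles that are still alone *)

Section isolated_velocity.
Context {R : realType} (mu : {measure set (measurableTypeR R) -> \bar R}).
Variables (u : R -> R) (phi al be : R -> R -> R).
Hypothesis H : sticky_core mu u phi al be.
Let fin := core_fin H.
Let ui := core_int H.

(** A one-point cluster may be massless, so free motion replaces means. The point [al (t + h) y]
    moves freely up to time [t + h] and is not to the right of [phi t y] at time [t], so its
    velocity bounds the difference quotient from above. That velocity is at most
    [t^-1 * (phi t y - al (t + h) y)], which converges even where [u] is discontinuous. The right
    end gives the lower bound. *)
Lemma isolated_derivative t y : 0 < t -> al t y = be t y ->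
  is_right_derivative (fun r => phi r y) t (u (al t y)).
Proof.
move=> tp e; rewrite /is_right_derivative; have t0 := ltW tp.
have cal := @cvg_al _ _ _ _ _ _ H _ y t0; have cbe := @cvg_be _ _ _ _ _ _ H _ y t0.
have xE : phi t y = al t y + t * u (al t y).
  by rewrite -(core_al H y t0 (lexx t)) (phi_al H).
have uE : u (al t y) = t^-1 * (phi t y - al t y).
  by rewrite xE addrC addKr mulKf ?gt_eqF.
have c1 : t^-1 * (phi t y - al (t + h) y) @[h --> 0^'+] --> u (al t y).
  by rewrite uE; apply: cvgMr => //; apply: cvgB => //; exact: cvg_cst.
have c2 : t^-1 * (phi t y - be (t + h) y) @[h --> 0^'+] --> u (al t y).
  by rewrite uE [in X in _ --> X]e; apply: cvgMr => //; apply: cvgB => //; exact: cvg_cst.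
apply: (squeeze_cvgr _ c2 c1).
near=> h.
have h0 : 0 < h by [].
have th0 : 0 <= t + h by lra.
have tth : t <= t + h by lra.
have A1 := core_al H y th0 (lexx _); have A2 := core_al H y t0 tth.
have B1 := core_be H y th0 (lexx _); have B2 := core_be H y t0 tth.
rewrite (phi_al H) // in A1; rewrite (phi_be H) // in B1.
have A3 := core_mono H t0 (al_le H y th0).
have B3 := core_mono H t0 (be_ge H y th0).
apply/andP; split.
  rewrite ler_pdivlMl// mulrCA ler_pdivrMl//.
  have : t * (phi (t + h) y - phi t y) >= t * (h * u (be (t + h) y)).
    by rewrite ler_pM2l//; lra.
  have : h * (phi t (be (t + h) y) - be (t + h) y) = t * (h * u (be (t + h) y)).
    by rewrite B2; lra.
  by nra.
rewrite ler_pdivrMl// mulrCA ler_pdivlMl//.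
have : t * (phi (t + h) y - phi t y) <= t * (h * u (al (t + h) y)).
  by rewrite ler_pM2l//; lra.
have : h * (phi t (al (t + h) y) - al (t + h) y) = t * (h * u (al (t + h) y)).
  by rewrite A2; lra.
by nra.
Unshelve. all: by end_near.
Qed.

(** The barycentre inequality on [[y, a]] is weakened by [y <= x] and [phi t x <= phi t a]. The
    error term vanishes as [y] tends to [a], which will bound [u0_minus] by [u a]. *)
Lemma isolated_average_left t a y : 0 < t -> al t a = be t a -> y < a ->
  average mu `[y, a[ u <= u a + t^-1 * (a - y).
Proof.
move=> tp e ya; have t0 := ltW tp.
have aE : al t a = a by have /andP[] := albe_in H a t0; lra.
have bE : be t a = a by rewrite -e.
have phia : phi t a = a + t * u a by have := core_al H a t0 (lexx t); rewrite aE.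
have gi := core_driftphi H t0.
have := saturated_upper H t0 bE (ltW ya).
(* A possible atom at [a] drops out, since the integrand vanishes there. *)
rewrite (int_split_co gi (ltW ya) (lexx a)) [X in _ + X](_ : _ = 0); last first.
  rewrite -[RHS](mul0r (fine (mu `[a, a]%classic))) -Rintegral_cst//.
  apply: eq_Rintegral => x; rewrite inE/= in_itv/= => /andP[h1 h2].
  have -> : x = a by lra.
  by rewrite phia; lra.
rewrite addr0 => le0.
have sub : `[y, a[ `<=` `[y, a] by exact: subset_itv_co_cc.
have hi : loc_integrable mu (fun x => t * u x - (phi t a - y)).
  by apply: loc_integrableB; [exact: loc_integrableZ|exact: loc_integrable_cst].
have le1 : \int[mu]_(x in `[y, a[) (t * u x - (phi t a - y)) <= 0.
  apply: le_trans le0; apply: (int_le (a := y) (b := a)) => // x /=.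
  by rewrite in_itv/= => /andP[h1 h2]; have := core_mono H t0 (ltW h2); lra.
rewrite (int_B (a := y) (b := a)) // in le1; [|exact: loc_integrableZ|exact: loc_integrable_cst].
rewrite (int_Z (a := y) (b := a)) // Rintegral_cst // in le1.
have mp : 0 < fine (mu `[y, a[%classic).
  apply: (fine_mu_gt0 fin (a := y) (b := a)) => //.
  apply: lt_le_trans (core_pos H ya) _; apply: le_measure; rewrite ?inE//.
  exact: subset_itv_oo_co.
rewrite /average ler_pdivrMl// -(ler_pM2l tp).
rewrite phia in le1.
have -> : t * (fine (mu `[y, a[%classic) * (u a + t^-1 * (a - y))) =
   fine (mu `[y, a[%classic) * (t * u a + (t * t^-1) * (a - y)) by lra.
by rewrite mulfV ?gt_eqF//; lra.
Qed.

Lemma isolated_average_right t a y : 0 < t -> al t a = be t a -> a < y ->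
  u a - t^-1 * (y - a) <= average mu `]a, y] u.
Proof.
move=> tp e ya; have t0 := ltW tp.
have aE : al t a = a by have /andP[] := albe_in H a t0; lra.
have phia : phi t a = a + t * u a by have := core_al H a t0 (lexx t); rewrite aE.
have gi := core_driftphi H t0.
have := saturated_lower H t0 aE (ltW ya).
rewrite (int_split_oc gi (lexx a) (ltW ya)) [X in X + _](_ : _ = 0); last first.
  rewrite -[RHS](mul0r (fine (mu `[a, a]%classic))) -Rintegral_cst//.
  apply: eq_Rintegral => x; rewrite inE/= in_itv/= => /andP[h1 h2].
  have -> : x = a by lra.
  by rewrite phia; lra.
rewrite add0r => le0.
have sub : `]a, y] `<=` `[a, y] by exact: subset_itv_oc_cc.
have hi : loc_integrable mu (fun x => t * u x - (phi t a - y)).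
  by apply: loc_integrableB; [exact: loc_integrableZ|exact: loc_integrable_cst].
have le1 : 0 <= \int[mu]_(x in `]a, y]) (t * u x - (phi t a - y)).
  apply: le_trans le0 _; apply: (int_le (a := a) (b := y)) => // x /=.
  by rewrite in_itv/= => /andP[h1 h2]; have := core_mono H t0 (ltW h1); lra.
rewrite (int_B (a := a) (b := y)) // in le1; [|exact: loc_integrableZ|exact: loc_integrable_cst].
rewrite (int_Z (a := a) (b := y)) // Rintegral_cst // in le1.
have mp : 0 < fine (mu `]a, y]%classic).
  apply: (fine_mu_gt0 fin (a := a) (b := y)) => //.
  apply: lt_le_trans (core_pos H ya) _; apply: le_measure; rewrite ?inE//.
  exact: subset_itv_oo_oc.
rewrite /average ler_pdivlMl// -(ler_pM2l tp).
rewrite phia in le1.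
have -> : t * (fine (mu `]a, y]%classic) * (u a - t^-1 * (y - a))) =
   fine (mu `]a, y]%classic) * (t * u a - (t * t^-1) * (y - a)) by lra.
by rewrite mulfV ?gt_eqF//; lra.
Qed.

End isolated_velocity.

(** * Velocities at time 0 *)

Section outer_regularity.
Context {R : realType} (nu : {measure set (measurableTypeR R) -> \bar R}).
Hypothesis nu_fin : (nu setT < +oo)%E.

Let nu_le (A B : set (measurableTypeR R)) : measurable A -> measurable B -> A `<=` B -> (nu A <= nu B)%E.
Proof. by move=> mA mB; apply: le_measure; rewrite inE. Qed.

(** Approximates [B] and its complement at once, which makes stability under complements
    immediate. *)
Let separated (B : set R) := forall e : R, 0 < e ->
  exists U V : set R, [/\ open U, open V, B `<=` U, ~` B `<=` V & (nu (U `&` V) < e%:E)%E].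

Let small_decreasing (F : nat -> set R) (e : R) : (forall n, open (F n)) ->
  (forall n m, (n <= m)%N -> F m `<=` F n) ->
  (nu (\bigcap_n F n) < e%:E)%E -> exists n, (nu (F n) < e%:E)%E.
Proof.
move=> oF dF lt; have mF n : measurable (F n : set (measurableTypeR R)) by exact: open_measurable.
have mI : measurable (\bigcap_n F n : set (measurableTypeR R)) by exact: bigcapT_measurable.
have cv : nu \o F @ \oo --> nu (\bigcap_n F n).
  apply: nonincreasing_cvg_mu => //; first exact: le_lt_trans (nu_le _ _ (@subsetT _ _)) nu_fin.
  by move=> n m nm; apply/subsetPset; exact: dF.
have [n _ /(_ n (leqnn n)) /= ?] := cv _ (open_ereal_lt' lt); by exists n.
Qed.

Let separated_sigma : sigma_algebra setT separated.
Proof.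
split.
- move=> e e0; exists set0, setT; split; [exact: open0|exact: openT|by []|by []|].
  by rewrite set0I measure0.
- move=> A sA e e0; have [U [V [oU oV AU AV UV]]] := sA _ e0.
  exists V, U; split=> //; first by rewrite setTD.
    by rewrite setTD setCK.
  by rewrite setIC.
- move=> A sA e e0.
  (* The tolerances add up to [e / 2], which leaves room for a strict inequality. *)
  pose d (n : nat) := (e / 2) / (2 ^ n.+1)%:R.
  have d0 n : 0 < d n by rewrite divr_gt0 ?divr_gt0// ltr0n expn_gt0.
  have /choice[U /choice[V UVP]] : forall n, exists U V : set R,
      [/\ open U, open V, A n `<=` U, ~` A n `<=` V & (nu (U `&` V) < (d n)%:E)%E].
    by move=> n; exact: sA.
  pose UU := \bigcup_n U n.
  have oUU : open UU by apply: bigcup_open => n _; have [] := UVP n.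
  (* The intersection of all the [V i] need not be open. Finite intersections are, and by continuity
     from above one of them is small enough. *)
  pose VV n := \bigcap_(i in `I_n) V i.
  have oVV n : open (VV n).
    by rewrite /VV bigcap_mkord; apply: (big_ind (@open R));
      [exact: openT|exact: openI|move=> i _; have [] := UVP i].
  have [n nP] : exists n, (nu (UU `&` VV n) < e%:E)%E.
    apply: small_decreasing.
    + by move=> n; exact: openI.
    + by move=> n m nm x [Ux Vx]; split=> // i /= im; apply: Vx => /=; exact: leq_trans nm.
    apply: (@le_lt_trans _ _ (nu (\bigcup_n (U n `&` V n)))).
      apply: nu_le.
      * by apply: bigcapT_measurable => n; apply: open_measurable; exact: openI.
      * by apply: bigcupT_measurable => n; apply: open_measurable; have [oU oV _ _ _] := UVP n; exact: openI.
      move=> x h; have [[n _ Unx] _] := h 0%N I.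
      by exists n => //; split=> //; have [_ ] := h n.+1 I; apply => /=.
    apply: (@le_lt_trans _ _ (\sum_(n <oo) (d n)%:E)%E).
      apply: le_trans (measure_sigma_subadditive _ _ _ (@subset_refl _ _)) _ => //.
      * by move=> n; apply: open_measurable; have [oU oV _ _ _] := UVP n; exact: openI.
      * by apply: bigcupT_measurable => n; apply: open_measurable; have [oU oV _ _ _] := UVP n; exact: openI.
      by apply: lee_nneseries => // n _; apply: ltW; have [] := UVP n.
    apply: le_lt_trans (epsilon_trick0 _ _) _; first lra.
    by rewrite lte_fin; lra.
  exists UU, (VV n); split=> //.
    by move=> x [k _ Akx]; exists k => //; have [_ _ + _ _] := UVP k; apply.
  move=> x nA i _; have [_ _ _ + _] := UVP i; apply=> Ai; apply: nA; by exists i.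
Qed.

Lemma outer_regular (B : set R) (e : R) : measurable (B : set (measurableTypeR R)) -> 0 < e ->
  exists U : set R, [/\ open U, B `<=` U & (nu (U `\` B) < e%:E)%E].
Proof.
move=> mB e0.
have : separated B.
  (* The rays []x, +oo[] generate the Borel sets, so it suffices to separate them. The overlap with
     [V n] decreases to the empty set. *)
  move: mB; rewrite /measurable/= [X in X B -> _]RGenOInfty.measurableE.
  move: B; apply: smallest_sub => // _ [x ->] d d0.
  pose V n : set R := `]-oo, x + n.+1%:R^-1[%classic.
  have [n nP] : exists n, (nu (`]x, +oo[ `&` V n) < d%:E)%E.
    apply: small_decreasing.
    - by move=> n; apply: openI; exact: interval_open.
    - move=> n m nm z [xz]; rewrite /V /= !in_itv/= => h; split=> //.
      by apply: lt_le_trans h _; rewrite lerD2l lef_pV2 ?posrE// ler_nat.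
    rewrite (_ : \bigcap_n _ = set0) ?measure0 ?lte_fin//.
    rewrite -subset0 => z h.
    have [+ _] := h 0%N I; rewrite /= in_itv/= andbT -subr_gt0 => zx.
    have [n _ /(_ n (leqnn n)) /= hn] := near_infty_natSinv_lt (PosNum zx).
    have [_ ] := h n I; rewrite /V /= in_itv/= => h2.
    by move: (n.+1%:R^-1) hn h2 => r; lra.
  exists (`]x, +oo[%classic), (V n); split=> //; try exact: interval_open.
  move=> z /=; rewrite !in_itv/= andbT => /negP; rewrite -leNgt => h.
  by apply: le_lt_trans h _; rewrite ltrDl invr_gt0.
move=> /(_ _ e0)[U [V [oU oV BU BV UV]]]; exists U; split=> //.
apply: le_lt_trans UV; apply: nu_le.
- by apply: measurableD => //; exact: open_measurable.
- by apply: open_measurable; exact: openI.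
- by move=> x [Ux /BV].
Qed.

End outer_regularity.

(** * The rising sun lemma *)

Section rising_sun.
Context {R : realType} (mu : {measure set (measurableTypeR R) -> \bar R}).
Variables (f : R -> R) (A B : R).
Hypothesis fi : loc_integrable mu f.

Definition rising (I : R * R) := [/\ A <= I.1, I.2 <= B &
  forall z, I.1 <= z <= I.2 -> 0 <= \int[mu]_(x in `[I.1, z]) f x].

Fixpoint cover (s : seq (R * R)) : set R :=
  if s is K :: s' then `[K.1, K.2]%classic `|` cover s' else set0.

Lemma coverP s x : cover s x <-> exists2 I, I \in s & I.1 <= x <= I.2.
Proof.
elim: s => [|I s IH] /=; first by split=> [//|[J]].
split=> [[|/IH[J Js xJ]]|[J]].
- by rewrite in_itv/= => xI; exists I; rewrite ?mem_head.
- by exists J => //; rewrite in_cons Js orbT.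
- rewrite in_cons => /orP[/eqP ->|Js] xJ; first by left; rewrite in_itv.
  by right; apply/IH; exists J.
Qed.

Lemma measurable_cover s : measurable (cover s : set (measurableTypeR R)).
Proof. by elim: s => [|I s IH] //=; exact: measurableU. Qed.

Lemma cover_sub s : (forall I, I \in s -> rising I) -> cover s `<=` `[A, B].
Proof.
move=> sP x /coverP[I /sP[h1 h2 _] /andP[h3 h4]] /=; rewrite in_itv/=.
by apply/andP; split; lra.
Qed.

(** An open ray is the increasing limit of the closed rays that end at [p - n.+1%:R^-1]; the
    distinction between open and closed matters when [p] is an atom. *)
Lemma int_left_ge0 (S : set R) p : measurable (S : set (measurableTypeR R)) -> S `<=` `[A, B] ->
  (forall z, 0 <= \int[mu]_(x in S `&` `]-oo, z]) f x) ->
  0 <= \int[mu]_(x in S `&` `]-oo, p[) f x.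
Proof.
move=> mS Sab h.
have mI (i : interval R) : measurable ((S `&` [set` i]) : set (measurableTypeR R)).
  by apply: measurableI => //; exact: measurable_itv.
have cv : \int[mu]_(x in S `&` `]-oo, p - n.+1%:R^-1]) f x @[n --> \oo] -->
    \int[mu]_(x in S `&` `]-oo, p[) f x.
  apply: (cvg_int (a := A) (b := B)) => //.
  - by move=> n; exact: mI.
  - exact: mI.
  - by move=> n x [/Sab].
  - by move=> x [/Sab].
  move=> x; have [xp|px] := ltP x p.
    have xp0 : 0 < p - x by lra.
    near=> n; rewrite /= !in_itv/=.
    have : n.+1%:R^-1 < p - x by near: n; exact: near_infty_natSinv_lt (PosNum xp0).
    move: (n.+1%:R^-1) => r rp; split=> -[? ?]; split=> //; lra.
  near=> n; rewrite /= !in_itv/=; have : 0 < n.+1%:R^-1 :> R by rewrite invr_gt0.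
  by move: (n.+1%:R^-1) => r rp; split=> -[? ?]; lra.
rewrite -(cvg_lim _ cv)//; apply: limr_ge; first by apply/cvg_ex; eexists; exact: cv.
by near=> n; exact: h.
Unshelve. all: by end_near.
Qed.

(* The right-most interval either is swallowed by the others or only has a tail
   of its own, so adding intervals from left to right preserves the sign. *)
Lemma sorted_cover_ge0 s z : (forall I, I \in s -> rising I) ->
  sorted (fun I J : R * R => J.1 <= I.1) s ->
  0 <= \int[mu]_(x in cover s `&` `]-oo, z]) f x.
Proof.
elim: s z => [|[p q] s IH] z sP /= ss.
  by rewrite set0I Rintegral_set0.
have sP' : forall I, I \in s -> rising I by move=> I Is; apply: sP; rewrite in_cons Is orbT.
have {IH} IH z' : 0 <= \int[mu]_(x in cover s `&` `]-oo, z']) f x.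
  by apply: IH => //; exact: path_sorted ss.
have smin : forall J, J \in s -> J.1 <= p.
  apply/allP; apply: (order_path_min _ ss) => J1 J2 J3 /= h1 h2; exact: le_trans h1.
have [Ap qB pqP] := sP _ (mem_head _ _); rewrite /= in Ap qB pqP.
(* An interval of [s] that reaches [q] starts at or left of [p], so it swallows [[p, q]]. *)
have [[J Js qJ]|no] := pselect (exists2 J, J \in s & q <= J.2).
  rewrite (_ : _ `|` _ = cover s)//; apply/seteqP; split=> x; last by right.
  move=> [|//]; rewrite /= in_itv/= => /andP[px xq]; apply/coverP; exists J => //.
  by rewrite (le_trans (smin _ Js))//= (le_trans xq).
have [zp|pz] := ltP z p.
  rewrite (_ : (_ `|` _) `&` _ = cover s `&` `]-oo, z])//.
  apply/seteqP; split=> x [h1 h2]; last by split=> //; right.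
  split=> //; case: h1 => //; move: h2; rewrite /= !in_itv/= => h2 /andP[h3 h4]; lra.
have [qp|pq] := ltP q p.
  by rewrite (_ : `[p, q]%classic = set0) ?set0U// set_itv_ge// bnd_simp -ltNge.
(* No other interval reaches [q], so from [p] on the union is [[p, q]] alone. The rest, left of [p],
   falls under the induction hypothesis. *)
rewrite (_ : (_ `|` _) `&` _ = (cover s `&` `]-oo, p[) `|` `[p, Num.min z q]); last first.
  apply/seteqP; split=> x.
    move=> [h1]; rewrite /= !in_itv/= => xz.
    have [xp|px] := ltP x p.
      left; split=> //; case: h1 => //; rewrite /= in_itv/= => /andP[]; lra.
    right; rewrite le_min xz/=; case: h1 => [|/coverP[J Js /andP[_ xJ]]].
      by rewrite /= in_itv/= => /andP[].
    have [//|qx] := leP x q.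
    by exfalso; apply: no; exists J => //; lra.
  move=> [[xs]|]; rewrite /= !in_itv/=.
    by move=> xp; split; [right|lra].
  by rewrite le_min => /and3P[px xz xq]; split=> //; left; rewrite px.
have mq : p <= Num.min z q by rewrite le_min pz.
rewrite (int_U (a := A) (b := B))//.
- rewrite addr_ge0//; first by apply: int_left_ge0 => //; [exact: measurable_cover|exact: cover_sub].
  by apply: pqP; rewrite mq ge_min lexx orbT.
- by apply: measurableI => //; exact: measurable_cover.
- by move=> x [/(cover_sub sP')].
- by apply: subset_itv; rewrite bnd_simp// ge_min qB orbT.
- by move=> x [_]; rewrite /= !in_itv/= => h /andP[]; lra.
Qed.

Lemma rising_cover_ge0 s : (forall I, I \in s -> rising I) ->
  0 <= \int[mu]_(x in cover s) f x.
Proof.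
move=> sP; pose s' := sort (fun I J : R * R => J.1 <= I.1) s.
have -> : cover s = cover s' `&` `]-oo, B].
  apply/seteqP; split=> x.
    move=> h; have := cover_sub sP h; rewrite /= !in_itv/= => /andP[_ xB]; split=> //.
    by move/coverP: h => [J Js xJ]; apply/coverP; exists J => //; rewrite mem_sort.
  by move=> [/coverP[J]]; rewrite mem_sort => Js xJ _; apply/coverP; exists J.
apply: sorted_cover_ge0; first by move=> I; rewrite mem_sort; exact: sP.
by apply: sort_sorted => I J; exact: le_total.
Qed.

Lemma rising_bigcup_ge0 (I : nat -> R * R) : (forall n, rising (I n)) ->
  0 <= \int[mu]_(x in \bigcup_n `[(I n).1, (I n).2]%classic) f x.
Proof.
move=> IP; pose S n := cover (mkseq I n).
have SP n J : J \in mkseq I n -> rising J by move=> /mapP[k _ ->].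
have cv : \int[mu]_(x in S n) f x @[n --> \oo] -->
    \int[mu]_(x in \bigcup_n `[(I n).1, (I n).2]%classic) f x.
  apply: (cvg_int (a := A) (b := B)) => //.
  - by move=> n; exact: measurable_cover.
  - exact: bigcupT_measurable.
  - by move=> n; apply: cover_sub; exact: SP.
  - move=> x [n _]; rewrite /= !in_itv/= => /andP[h1 h2].
    by have [h3 h4 _] := IP n; apply/andP; split; lra.
  move=> x; have [[n _ xn]|no] := pselect ((\bigcup_n `[(I n).1, (I n).2]%classic) x); last first.
    near=> m; split=> //; move=> /coverP[J /mapP[k _ ->] xk]; exists k => //.
  near=> m; split=> _; last first.
    apply/coverP; exists (I n); last by rewrite /= in_itv in xn.
    apply: map_f; rewrite mem_iota/= add0n.
    by near: m; exists n.+1.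
  by exists n.
rewrite -(cvg_lim _ cv)//; apply: limr_ge; first by apply/cvg_ex; eexists; exact: cv.
by near=> n; apply: rising_cover_ge0; exact: SP.
Unshelve. all: by end_near.
Qed.

End rising_sun.

(** * Points that start faster than their initial velocity *)

Section fast_points.
Context {R : realType} (mu : {measure set (measurableTypeR R) -> \bar R}).
Variables (u : R -> R) (phi al be : R -> R -> R).
Hypothesis H : sticky_core mu u phi al be.
Let fin := core_fin H.
Let ui := core_int H.

Definition rat_pair (k : nat) : rat * rat := odflt (0, 0) (unpickle k).

Lemma rat_pairK p : rat_pair (pickle p) = p.
Proof. by rewrite /rat_pair pickleK. Qed.

Let time k : R := ratr (rat_pair k).1.
Let label k : R := ratr (rat_pair k).2.

(* All initial segments of this part of the cluster of [label k] at time [time k]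
   have u-mean at least lam. *)
Definition fast_part (lam : R) (k : nat) : R * R :=
  (al (time k) (label k),
   Num.min (be (time k) (label k)) (phi (time k) (label k) - lam * time k)).

(** For [x <= z] in the fast part, [x - phi t y] is at most [- lam * t]. Hence the nonnegative
    integral given by [core_lower] is at most [t] times the integral of [u - lam]. *)
Lemma fast_part_rising lam k A B : 0 < time k -> A <= (fast_part lam k).1 ->
  (fast_part lam k).2 <= B -> rising mu (fun x => u x - lam) A B (fast_part lam k).
Proof.
rewrite /fast_part; set t := time k; set y := label k => /= tp hA hB; split=> // z /=.
rewrite le_min => /and3P[az zb zphi]; have t0 := ltW tp.
have := core_lower H t0 (introT andP (conj az zb)).
have li : loc_integrable mu (fun x => u x - lam).
  by apply: loc_integrableB => //; exact: loc_integrable_cst.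
have le : \int[mu]_(x in `[al t y, z]) (x + t * u x - phi t y) <=
    \int[mu]_(x in `[al t y, z]) (t * (u x - lam)).
  apply: (int_le (a := al t y) (b := z)) => //; first exact: (core_drift H).
    exact: loc_integrableZ.
  by move=> x /=; rewrite in_itv/= => /andP[_ xz]; lra.
move=> /le_trans/(_ le); rewrite (int_Z (a := al t y) (b := z))//.
by rewrite pmulr_rge0.
Qed.

(** Rational times and labels keep the unions countable and the set measurable; the window []- N,
    N[] keeps its mass finite. *)
Definition fast_points (lam' lam N : R) : set R :=
  (`]- N, N[ `&` u @^-1` `]-oo, lam']) `&`
  \bigcap_n \bigcup_k (if 0 < time k < n.+1%:R^-1
    then `[(fast_part lam k).1, (fast_part lam k).2]%classic else set0).

Lemma measurable_fast_points lam' lam N :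
  measurable (fast_points lam' lam N : set (measurableTypeR R)).
Proof.
apply: measurableI.
  have mu' : measurable_fun `]- N, N[%classic u.
    apply: measurable_funS (_ : measurable_fun `[- N, N]%classic u) => //.
      exact: subset_itv_oo_cc.
    by apply/measurable_EFinP; exact: measurable_int (ui _ _).
  by apply: mu' => //; exact: measurable_itv.
apply: bigcapT_measurable => n; apply: bigcupT_measurable => k.
by case: ifP.
Qed.

(** Let [G] be the union of the fast parts inside an open neighbourhood [U] of [E] of nearly the
    same mass. The rising sun lemma makes the integral of [u - lam] over [G] nonnegative, while [E]
    contributes at most [(lam' - lam) * fine (mu E)] and the remainder at most [e] by absolute
    continuity. *)
Lemma fast_points_null lam' lam N : lam' < lam -> 0 < N -> mu (fast_points lam' lam N) = 0%E.
Proof.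
move=> ll N0; set E := fast_points lam' lam N.
have mE : measurable (E : set (measurableTypeR R)) by exact: measurable_fast_points.
have EW : E `<=` `[- N, N] by move=> x [[+ _] _]; apply: subset_itv_oo_cc.
pose g x := u x - lam.
have gi : loc_integrable mu g by apply: loc_integrableB => //; exact: loc_integrable_cst.
have muE : mu E \is a fin_num.
  rewrite ge0_fin_numE//; apply: le_lt_trans (fin (- N) N).
  by apply: le_measure; rewrite ?inE.
suff small e : 0 < e -> (lam - lam') * fine (mu E) <= e.
  rewrite -(fineK muE); congr (_%:E); apply/le_anti; rewrite fine_ge0// andbT.
  rewrite leNgt; apply/negP => p.
  have p' : 0 < (lam - lam') * fine (mu E) by rewrite mulr_gt0// subr_gt0.
  have := small ((lam - lam') * fine (mu E) / 2); lra.
move=> e0.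
have mW : measurable (`[- N, N]%classic : set (measurableTypeR R)) by [].
have Wi : mu.-integrable setT (EFin \o (g \_ `[- N, N])).
  by rewrite -restrict_EFin; apply/(integrable_mkcond _ mW); exact: gi.
have [d [d0 dP]] := integral_normr_continuous Wi e0.
(* Outer regularity was proved for finite measures, hence the restriction to the window. *)
have nu_fin : (mrestr mu mW setT < +oo)%E by rewrite /mrestr setTI.
have [U0 [oU0 EU0 U0E]] := outer_regular nu_fin mE d0.
pose U := U0 `&` `]- N, N[.
have oU : open U by apply: openI => //; exact: interval_open.
have EU : E `<=` U by move=> x Ex; split; [exact: EU0|case: Ex => -[]].
have UW : U `<=` `[- N, N] by move=> x [_]; exact: subset_itv_oo_cc.
pose P k := [/\ 0 < time k, (fast_part lam k).1 <= (fast_part lam k).2 &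
  `[(fast_part lam k).1, (fast_part lam k).2] `<=` U].
(* The pair [(N, - N)] encodes an empty interval, which is rising vacuously. *)
pose I k := if pselect (P k) is left _ then fast_part lam k else (N, - N).
pose G := \bigcup_k `[(I k).1, (I k).2]%classic.
have IP k : rising mu g (- N) N (I k).
  rewrite /I; case: pselect => [[h0 h1 h2]|_].
    apply: fast_part_rising => //.
      have : U (fast_part lam k).1 by apply: h2; rewrite /= in_itv/= lexx.
      by move=> /UW; rewrite /= in_itv/= => /andP[].
    have : U (fast_part lam k).2 by apply: h2; rewrite /= in_itv/= lexx andbT.
    by move=> /UW; rewrite /= in_itv/= => /andP[].
  by split=> /= [||z /andP[]]; lra.
have mG : measurable (G : set (measurableTypeR R)) by exact: bigcupT_measurable.
have GU : G `<=` U.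
  move=> x [k _]; rewrite /I; case: pselect => [[_ _ h]|_ /=]; first exact: h.
  by rewrite in_itv/= => /andP[]; lra.
have EG : E `<=` G.
  (* At time 0 the cluster of [a] is a single point, so at short times it stays within [U], and so
     does every fast part that contains [a]. *)
  move=> a Ea; have Ua := EU _ Ea.
  have /nbhs_ballP[r /= r0 rU] : nbhs a U by exact: open_nbhs_nbhs.
  have [|h1 h10 h1P] := @al_shrink _ _ _ _ _ _ H 0 a (a - r) (lexx 0).
    by rewrite (al0 H); lra.
  have [|h2 h20 h2P] := @be_shrink _ _ _ _ _ _ H 0 a (a + r) (lexx 0).
    by rewrite (be0 H); lra.
  have m0 : 0 < Num.min h1 h2 by rewrite lt_min h10.
  have [n _ /(_ n (leqnn n)) /= nm] := near_infty_natSinv_lt (PosNum m0).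
  have [_ /(_ n Logic.I)[k _]] := Ea; case: ifP => // /andP[t0 tn] ak.
  have tm := lt_trans tn nm; rewrite lt_min in tm; case/andP: tm => tm1 tm2.
  have := h1P _ t0 (ltW tm1); have := h2P _ t0 (ltW tm2); rewrite add0r => Bb Aa.
  have ee : al (time k) (label k) = al (time k) a /\ be (time k) (label k) = be (time k) a.
    apply: (cluster_eq H (ltW t0)); apply/esym/(core_cluster H _ _ (ltW t0)).
    by move: ak; rewrite /= in_itv/= le_min => /and3P[-> ->].
  have Pk : P k.
    split=> //; first by move: ak; rewrite /= in_itv/= => /andP[]; exact: le_trans.
    move=> x; rewrite /= in_itv/= le_min ee.1 ee.2 => /and3P[h3 h4 _].
    by apply: rU; rewrite /ball/= ltr_norml; apply/andP; split; lra.
  by exists k => //; rewrite /I; case: pselect.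
have GW := subset_trans GU UW.
have mGE : measurable (G `\` E : set (measurableTypeR R)) by exact: measurableD.
have GEW : G `\` E `<=` `[- N, N] by move=> x [/GW].
have tail : \int[mu]_(x in G `\` E) g x <= e.
  have muGE : (mu (G `\` E) < d%:E)%E.
    apply: le_lt_trans U0E; rewrite /mrestr; apply: le_measure; rewrite ?inE//.
      by apply: measurableI => //; apply: measurableD => //; exact: open_measurable.
    by move=> x [Gx nEx]; split; [split=> //; case: (GU _ Gx)|exact: GW].
  apply: ltW; apply: le_lt_trans (dP _ mGE muGE).
  have -> : \int[mu]_(x in G `\` E) `|(g \_ `[- N, N]) x| = \int[mu]_(x in G `\` E) `|g x|.
    by apply: eq_Rintegral => x; rewrite inE => /GEW xW; rewrite patchE mem_set.
  apply: (int_le (a := - N) (b := N)) => //; first exact: loc_integrable_norm.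
  by move=> x _; exact: ler_norm.
have main : \int[mu]_(x in E) g x <= (lam' - lam) * fine (mu E).
  rewrite -Rintegral_cst//; apply: (int_le (a := - N) (b := N)) => //.
    exact: loc_integrable_cst.
  by move=> x [[_]]; rewrite /= in_itv/= /g => h _; lra.
have := rising_bigcup_ge0 gi IP; rewrite -/G.
by move: tail; rewrite (int_setD (a := - N) (b := N))//; lra.
Qed.

Lemma phi_right_continuous t y : 0 < t -> phi (t + h) y @[h --> 0^'+] --> phi t y.
Proof.
move=> tp.
have [l hl] : exists l, is_right_derivative (fun r => phi r y) t l.
  have := al_le_be H y (ltW tp); rewrite le_eqVlt => /orP[/eqP e|lt].
    by exists (u (al t y)); exact: (isolated_derivative H tp e).
  by exists (average mu `[al t y, be t y] u); exact: (cluster_derivative H (ltW tp) lt).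
have h0 : (fun h : R => h) h @[h --> 0^'+] --> (0 : R) by apply: cvg_at_right_filter; exact: cvg_id.
have c : h * (h^-1 * (phi (t + h) y - phi t y)) + phi t y @[h --> 0^'+] --> 0 * l + phi t y.
  by apply: cvgD; [exact: cvgM|exact: cvg_cst].
rewrite mul0r add0r in c.
apply: (cvg_trans _ c); apply: near_eq_cvg; near=> h.
have h00 : 0 < h by [].
by rewrite /= mulrA mulfV ?gt_eqF// mul1r subrK.
Unshelve. all: by end_near.
Qed.

(** The null set is a countable union over pairs of rationals and integer windows. Outside it, too
    large a displacement at a short rational time would put [a] in a fast part; right continuity in
    time extends the bound to real times. *)
Lemma initial_velocity_upper : exists N : set (measurableTypeR R),
  [/\ measurable N, mu N = 0%E & forall a, ~ N a -> forall lam, u a < lam ->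
    exists2 h0, 0 < h0 & forall h, 0 < h -> h < h0 -> phi h a <= a + lam * h].
Proof.
pose F k n := if ratr (rat_pair k).1 < ratr (rat_pair k).2 :> R then
  fast_points (ratr (rat_pair k).1) (ratr (rat_pair k).2) n.+1%:R else set0.
exists (\bigcup_k \bigcup_n F k n); split.
- apply: bigcupT_measurable => k; apply: bigcupT_measurable => n; rewrite /F.
  by case: ifP => // _; exact: measurable_fast_points.
- apply/eqP; rewrite -measure_le0.
  apply: le_trans (measure_sigma_subadditive _ _ _ (@subset_refl _ _)) _.
  + by move=> k; apply: bigcupT_measurable => n; rewrite /F; case: ifP => // _; exact: measurable_fast_points.
  + apply: bigcupT_measurable => k; apply: bigcupT_measurable => n; rewrite /F.
    by case: ifP => // _; exact: measurable_fast_points.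
  rewrite eseries0// => k _ _; apply/eqP; rewrite -measure_le0.
  have mF n : measurable (F k n : set (measurableTypeR R)).
    by rewrite /F; case: ifP => // _; exact: measurable_fast_points.
  apply: le_trans (measure_sigma_subadditive _ _ _ (@subset_refl _ _)) _ => //.
    exact: bigcupT_measurable.
  rewrite eseries0// => n _ _; rewrite /F; case: ifP => [lt|_]; last exact: measure0.
  by apply: fast_points_null.
move=> a Na lam ulam.
have [q1] := rat_in_itvoo ulam; rewrite in_itv/= => /andP[uq1 q1l].
have [q2] := rat_in_itvoo q1l; rewrite in_itv/= => /andP[q12 q2l].
have [M Mm] : exists M : nat, `|a| < M.+1%:R.
  by exists (Num.truncn `|a|); exact: truncnS_gt.
have nE : ~ fast_points (ratr q1) (ratr q2) M.+1%:R a.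
  move=> Ea; apply: Na; exists (pickle (q1, q2)); [exact: I|exists M; [exact: I|]].
  by rewrite /F rat_pairK /= q12.
have [n nP] : exists n, ~ (\bigcup_k (if 0 < time k < n.+1%:R^-1
    then `[(fast_part (ratr q2) k).1, (fast_part (ratr q2) k).2]%classic else set0)) a.
  apply: contrapT => /forallNP h; apply: nE; split.
    split=> /=; rewrite in_itv/=; last exact: ltW.
    by rewrite -ltr_norml.
  by move=> n _; apply: contrapT; exact: h.
have n0 : 0 < n.+1%:R^-1 :> R by rewrite invr_gt0.
exists n.+1%:R^-1 => //.
have rational (q : rat) : 0 < ratr q :> R -> ratr q < n.+1%:R^-1 :> R ->
    phi (ratr q) a <= a + ratr q2 * ratr q.
  move=> qp qn; rewrite leNgt; apply/negP => bad.
  have q0 := ltW qp.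
  (* In a one-point cluster [a] has moved at velocity [u a], which is below [q2]. Otherwise the
     cluster contains a rational that serves as its label. *)
  have := al_le_be H a q0; rewrite le_eqVlt => /orP[/eqP e|lt].
    have aE : al (ratr q) a = a by have /andP[] := albe_in H a q0; lra.
    have := core_al H a q0 (lexx _); rewrite aE.
    have : u a * ratr q < ratr q2 * ratr q by rewrite ltr_pM2r//; lra.
    by lra.
  have [r] := rat_in_itvoo lt; rewrite in_itv/= => /andP[r1 r2].
  have pe : phi (ratr q) (ratr r) = phi (ratr q) a.
    by apply/(core_cluster H _ _ q0); rewrite !ltW.
  have [e1 e2] := cluster_eq H q0 pe.
  apply: nP; exists (pickle (q, r)); [exact: I|].
  rewrite /fast_part /time /label rat_pairK /= qp qn /= in_itv/= e1 e2 pe le_min.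
  by have /andP[-> ->] := albe_in H a q0; rewrite /=; lra.
move=> h hp hn; rewrite leNgt; apply/negP => bad.
have cv := @phi_right_continuous h a hp.
have gap : 0 < phi h a - (a + ratr q2 * h).
  have : ratr q2 * h < lam * h by rewrite ltr_pM2r.
  by lra.
have c2 : phi (h + k) a - (a + ratr q2 * (h + k)) @[k --> 0^'+] -->
    phi h a - (a + ratr q2 * (h + 0)).
  have k0 : (fun k : R => k) k @[k --> 0^'+] --> (0 : R) by apply: cvg_at_right_filter; exact: cvg_id.
  apply: cvgB => //; apply: cvgD; first exact: cvg_cst.
  by apply: cvgMr; apply: cvgD => //; exact: cvg_cst.
rewrite addr0 in c2.
have [k0 /= k00 k0P] := cvgr_gt _ c2 _ gap.
(* Keeps a rational time just after [h] inside the range where the strict inequality persists and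
   below the threshold [n.+1%:R^-1]. *)
pose k1 := Num.min (k0 / 2) (n.+1%:R^-1 - h).
have k1p : 0 < k1 by rewrite lt_min subr_gt0 hn andbT; lra.
have hk : h < h + k1 by lra.
have [q] := rat_in_itvoo hk; rewrite in_itv/= => /andP[hq qhk].
have := k0P (ratr q - h); rewrite /ball/= sub0r normrN gtr0_norm ?subr_gt0//.
have qk : ratr q - h < k1 by lra.
move: (qk); rewrite lt_min => /andP[qk0 qn].
have q' : h + (ratr q - h) = ratr q by lra.
rewrite q' => K; have qp : 0 < ratr q :> R by exact: lt_trans hq.
have qn' : ratr q < n.+1%:R^-1 :> R by rewrite -(ltrD2r (- h)).
have h1 : ratr q - h < k0 by lra.
have := K h1 hq; have := rational q qp qn'; lra.
Qed.

End fast_points.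

Section initial_velocity.
Context {R : realType} (mu : {measure set (measurableTypeR R) -> \bar R}).
Variables (u : R -> R) (phi al be : R -> R -> R).
Hypothesis H : sticky_core mu u phi al be.

(** The upper estimate, applied to the flow and to its reflection, bounds the velocity from both
    sides. *)
Lemma initial_velocity : exists N : set (measurableTypeR R),
  [/\ measurable N, mu N = 0%E &
   forall a, ~ N a -> is_right_derivative (fun r => phi r a) 0 (u a)].
Proof.
have [N1 [mN1 N10 N1P]] := initial_velocity_upper H.
have [N2 [mN2 N20 N2P]] := initial_velocity_upper (core_reflected H).
have mN2' : measurable (-%R @^-1` N2 : set (measurableTypeR R)).
  by rewrite -[X in measurable X]setTI; exact: oppr_measurable.
exists (N1 `|` -%R @^-1` N2); split.
- exact: measurableU.
- by rewrite null_set_setU//; exact: N20.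
move=> a /not_orP[Na1 Na2]; apply/cvgrPdist_le => e e0.
have [|h1 h10 h1P] := N1P _ Na1 (u a + e); first lra.
have [|h2 h20 h2P] := N2P _ Na2 (- u a + e); first by rewrite opprK; lra.
near=> h.
have h0 : 0 < h by [].
have := h1P h h0; have := h2P h h0; rewrite opprK => /(_ _)P2 /(_ _)P1.
have {}P1 : phi h a <= a + (u a + e) * h by apply: P1; near: h; exact: nbhs_right_lt.
have {}P2 : - phi h a <= - a + (- u a + e) * h by apply: P2; near: h; exact: nbhs_right_lt.
rewrite add0r (core_id H) distrC ler_norml; apply/andP; split.
  by rewrite lerBrDr ler_pdivlMl//; lra.
by rewrite lerBlDr ler_pdivrMl//; lra.
Unshelve. all: by end_near.
Qed.

End initial_velocity.

(** * Shock times and turbulent intervals *)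

Section flow.
Context {R : realType} (mu : {measure set (measurableTypeR R) -> \bar R}).
Variables (u : R -> R) (phi : R -> R -> R -> R).
Hypotheses (Hadm : admissible mu u) (Hflow : sticky_flow mu u phi).

(** Indexed by a particle rather than by a position, as [sticky_core] expects. *)
Definition left_end (t y : R) : R := cluster_left phi (phi 0 t y) 0 t.
Definition right_end (t y : R) : R := cluster_right phi (phi 0 t y) 0 t.

Let fin a b : (mu `[a, b]%classic < +oo)%E.
Proof. by apply: (adm_radon Hadm); exact: segment_compact. Qed.

Let pos a b : a < b -> (0 < mu `]a, b[%classic)%E.
Proof.
move=> ab; have : msupport mu ((a + b) / 2) by rewrite (adm_support Hadm).
by apply; [exact: interval_open|rewrite /= in_itv/=; apply/andP; split; lra].
Qed.

Let ui : loc_integrable mu u.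
Proof. by move=> a b; apply: (adm_integrable Hadm); exact: segment_compact. Qed.

Lemma clusterP t x z : 0 <= t ->
  phi 0 t z = x <-> cluster_left phi x 0 t <= z <= cluster_right phi x 0 t.
Proof.
move=> t0; have [_ e] := flow_cluster Hflow x t0.
by rewrite -[phi 0 t z = x]/((phi 0 t @^-1` [set x]) z) e /= in_itv.
Qed.

Let Ti t : loc_integrable mu (fun a => a + t * u a).
Proof. by apply: loc_integrableD; [exact: loc_integrable_id|exact: loc_integrableZ]. Qed.

Let drift_average t x S a b : measurable (S : set (measurableTypeR R)) -> S `<=` `[a, b] ->
  (0 < mu S)%E ->
  \int[mu]_(y in S) (y + t * u y - x) =
    (average mu S (fun y => y + t * u y) - x) * fine (mu S).
Proof.
move=> mS Sab S0; rewrite (int_B mS Sab)//; last exact: loc_integrable_cst.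
rewrite Rintegral_cst// /average mulrBl mulrAC mulVf ?mul1r//.
by rewrite gt_eqF// (fine_mu_gt0 fin mS Sab).
Qed.

Let total t y : 0 <= t ->
  \int[mu]_(x in `[left_end t y, right_end t y]) (x + t * u x - phi 0 t y) = 0.
Proof.
move=> t0; have [le _] := flow_cluster Hflow (phi 0 t y) t0.
have [lt|ge] := ltP (left_end t y) (right_end t y).
  rewrite (@drift_average _ _ _ (left_end t y) (right_end t y))//.
    by rewrite -(flow_barycentre Hflow t0 lt) subrr mul0r.
  by apply: lt_le_trans (pos lt) _; apply: le_measure; rewrite ?inE//; exact: subset_itv_oo_cc.
(* On a one-point cluster the integrand vanishes by [flow_endpoints], whatever the mass of the
   point. *)
have e : left_end t y = right_end t y by apply/le_anti; rewrite ge andbT.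
have [xa _] := flow_endpoints Hflow (phi 0 t y) t0.
rewrite -e -[RHS](mul0r (fine (mu `[left_end t y, left_end t y]%classic))) -Rintegral_cst//.
apply: eq_Rintegral => x; rewrite inE/= in_itv/= => /andP[h1 h2].
have -> : x = left_end t y by lra.
by rewrite {1}xa -/(left_end t y) subrr.
Qed.

Let lower t y z : 0 <= t -> left_end t y <= z <= right_end t y ->
  0 <= \int[mu]_(x in `[left_end t y, z]) (x + t * u x - phi 0 t y).
Proof.
move=> t0 /andP[az]; rewrite le_eqVlt => /orP[/eqP ->|zb]; first by rewrite total.
have m2 : (0 < mu `]z, right_end t y]%classic)%E.
  apply: lt_le_trans (pos zb) _; apply: le_measure; rewrite ?inE//; exact: subset_itv_oo_oc.
have [m1|] := boolP (0 < mu `[left_end t y, z]%classic)%E.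
  rewrite (@drift_average _ _ _ (left_end t y) z)//.
  have [_ h] := flow_partial_barycentres Hflow t0 m1 m2.
  by rewrite mulr_ge0 ?fine_ge0// subr_ge0.
rewrite -leNgt measure_le0 => /eqP m1.
rewrite (int_B (a := left_end t y) (b := z))//; last exact: loc_integrable_cst.
rewrite Rintegral_cst// m1 mulr0 subr0 /Rintegral null_set_integral//.
by apply: measurable_int; exact: Ti.
Qed.

Lemma flow_core : sticky_core mu u (phi 0) left_end right_end.
Proof.
split=> //.
- by move=> y; exact: (flow_id Hflow _ (lexx 0)).
- by move=> t t0; exact: (flow_nondecreasing Hflow (lexx 0) t0).
- by move=> t y z t0; exact: clusterP.
- move=> s t y z s0 st e; have ts0 : 0 <= t - s by lra.
  have -> : t = s + (t - s) by lra.
  by rewrite -!(flow_semigroup Hflow _ s0 ts0) e.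
- by move=> s t y s0 st; have [] := flow_free_endpoints Hflow (phi 0 t y) s0 st.
- by move=> s t y s0 st; have [] := flow_free_endpoints Hflow (phi 0 t y) s0 st.
(* The integral over the whole cluster is 0, so the claim is a lower bound over [[left_end t y, z[].
   It follows from the closed initial segments by [int_left_ge0]. *)
- move=> t y z t0 /andP[az zb]; set g := fun x : R => x + t * u x - phi 0 t y.
  have gi : loc_integrable mu g by apply: loc_integrableB => //; exact: loc_integrable_cst.
  have := total y t0; rewrite -/g (int_split_co gi az zb) => e.
  suff : 0 <= \int[mu]_(x in `[left_end t y, z[) g x by lra.
  have -> : `[left_end t y, z[%classic = `[left_end t y, right_end t y] `&` `]-oo, z[.
    apply/seteqP; split=> x /=; rewrite !in_itv/=.
      by move=> /andP[-> xz]; split=> //; rewrite (le_trans (ltW xz)).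
    by move=> [/andP[->]].
  apply: (int_left_ge0 (A := left_end t y) (B := right_end t y)) => // w.
  have [wa|aw] := ltP w (left_end t y).
    rewrite (_ : _ `&` _ = set0) ?Rintegral_set0//; rewrite -subset0 => x [] /=.
    by rewrite !in_itv/= => /andP[h1 h2]; lra.
  have [wb|bw] := leP w (right_end t y).
    rewrite (_ : _ `&` _ = `[left_end t y, w]%classic); first by apply: lower; rewrite ?aw.
    apply/seteqP; split=> x /=; rewrite !in_itv/=.
      by move=> [/andP[->]].
    by move=> /andP[-> xw]; split=> //; rewrite (le_trans xw).
  rewrite (_ : _ `&` _ = `[left_end t y, right_end t y]%classic); first by rewrite total.
  apply/seteqP; split=> x /=; rewrite !in_itv/=; first by case.
  by move=> /andP[-> xb]; split=> //; rewrite (le_trans xb)// ltW.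
Qed.

Let H := flow_core.

(** By the barycentre identity, [t] times the mean of [u] is [y] minus the mean initial position,
    and the latter lies between the cluster ends. *)
Lemma velocity_bounds t y : 0 < t ->
  t^-1 * (y - cluster_right phi y 0 t) <= velocity mu u phi y t <=
  t^-1 * (y - cluster_left phi y 0 t).
Proof.
move=> tp; have t0 := ltW tp; rewrite /velocity.
set a := cluster_left _ _ _ _; set b := cluster_right _ _ _ _.
have [le _] := flow_cluster Hflow y t0; rewrite -/a -/b in le.
rewrite !(ler_pdivrMl, ler_pdivlMl)//.
case: ifPn => [lt|]; last first.
  rewrite -leNgt => ge; have [ya yb] := flow_endpoints Hflow y t0.
  have e : b = a by lra.
  by rewrite -/a -/b in ya yb; apply/andP; rewrite e; split; lra.
have yE := flow_barycentre Hflow t0 lt; rewrite -/a -/b in yE.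
have mp : 0 < fine (mu `[a, b]%classic) by exact: (mu_itv_gt0 H lt).
have tE : t * average mu `[a, b] u = y - average mu `[a, b] id.
  rewrite {1}yE /average (int_D (a := a) (b := b))//; first last.
  - exact: loc_integrableZ.
  - exact: loc_integrable_id.
  by rewrite (int_Z (a := a) (b := b))//; lra.
have low : a <= average mu `[a, b] id.
  rewrite /average ler_pdivlMl// mulrC -Rintegral_cst//.
  apply: (int_le (a := a) (b := b)) => //; [exact: loc_integrable_cst|exact: loc_integrable_id|].
  by move=> x /=; rewrite in_itv/= => /andP[].
have high : average mu `[a, b] id <= b.
  rewrite /average ler_pdivrMl// mulrC -Rintegral_cst//.
  apply: (int_le (a := a) (b := b)) => //; [exact: loc_integrable_id|exact: loc_integrable_cst|].
  by move=> x /=; rewrite in_itv/= => /andP[].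
by rewrite tE; apply/andP; split; lra.
Qed.

Let end_velocity t y : 0 < t ->
  u (left_end t y) = t^-1 * (phi 0 t y - left_end t y) /\
  u (right_end t y) = t^-1 * (phi 0 t y - right_end t y).
Proof.
move=> tp; have [xa xb] := flow_endpoints Hflow (phi 0 t y) (ltW tp).
rewrite -/(left_end t y) in xa; rewrite -/(right_end t y) in xb.
by split; [rewrite {1}xa|rewrite {1}xb]; rewrite [_ + t * _]addrC addrK mulKf ?gt_eqF.
Qed.

(** The cluster at a position slightly left of [x] lies in []al - t * e, al[], so [velocity_bounds]
    puts its velocity within [e] of [t^-1 * (x - al)]. *)
Lemma velocity_minusE t a : 0 < t ->
  velocity_minus mu u phi (phi 0 t a) t = (u (left_end t a))%:E.
Proof.
move=> tp; have t0 := ltW tp; rewrite /velocity_minus gt_eqF//; congr (_%:E).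
apply: cvg_lim => //; have [-> _] := end_velocity a tp.
set x := phi 0 t a; set al := left_end t a.
apply/cvgrPdist_le => e e0; have te : 0 < t * e by rewrite mulr_gt0.
have lt : phi 0 t (al - t * e) < x.
  rewrite lt_neqAle; apply/andP; split; last first.
    by rewrite /x -(phi_al H a t0) (core_mono H t0)//; rewrite -/al; lra.
  by apply/eqP => /(clusterP _ _ t0)/andP[]; rewrite -/(left_end t a) -/al; lra.
near=> y.
have yx : y < x by [].
have ylow : phi 0 t (al - t * e) < y by near: y; exact: nbhs_left_gt.
have xye : x - t * e < y by near: y; apply: nbhs_left_gt; lra.
have [lr _] := flow_cluster Hflow y t0.
have /clusterP yl : cluster_left phi y 0 t <= cluster_left phi y 0 t <= cluster_right phi y 0 t.
  by rewrite lexx.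
have /clusterP yr : cluster_left phi y 0 t <= cluster_right phi y 0 t <= cluster_right phi y 0 t.
  by rewrite lexx andbT.
have h1 : al - t * e < cluster_left phi y 0 t.
  rewrite ltNge; apply/negP => /(core_mono H t0); rewrite (yl t0); lra.
have h2 : cluster_right phi y 0 t < al.
  rewrite ltNge; apply/negP => /(core_mono H t0).
  by rewrite (yr t0) (phi_al H)// -/x; lra.
have /andP[v1 v2] := velocity_bounds y tp.
rewrite ler_norml; apply/andP; split.
  have : t^-1 * (y - cluster_left phi y 0 t) <= t^-1 * (x - al + t * e).
    by rewrite ler_pM2l ?invr_gt0//; lra.
  by rewrite [X in _ <= X]mulrDr mulKf ?gt_eqF//; lra.
have : t^-1 * (x - al - t * e) <= t^-1 * (y - cluster_right phi y 0 t).
  by rewrite ler_pM2l ?invr_gt0//; lra.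
by rewrite mulrBr mulKf ?gt_eqF//; lra.
Unshelve. all: by end_near.
Qed.

Lemma velocity_plusE t a : 0 < t ->
  velocity_plus mu u phi (phi 0 t a) t = (u (right_end t a))%:E.
Proof.
move=> tp; have t0 := ltW tp; rewrite /velocity_plus gt_eqF//; congr (_%:E).
apply: cvg_lim => //; have [_ ->] := end_velocity a tp.
set x := phi 0 t a; set be := right_end t a.
apply/cvgrPdist_le => e e0; have te : 0 < t * e by rewrite mulr_gt0.
have lt : x < phi 0 t (be + t * e).
  rewrite lt_neqAle; apply/andP; split; last first.
    by rewrite /x -(phi_be H a t0) (core_mono H t0)//; rewrite -/be; lra.
  by apply/eqP => /esym/(clusterP _ _ t0)/andP[_]; rewrite -/(right_end t a) -/be; lra.
near=> y.
have yx : x < y by [].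
have ylow : y < phi 0 t (be + t * e) by near: y; exact: nbhs_right_lt.
have xye : y < x + t * e by near: y; apply: nbhs_right_lt; lra.
have [lr _] := flow_cluster Hflow y t0.
have /clusterP yl : cluster_left phi y 0 t <= cluster_left phi y 0 t <= cluster_right phi y 0 t.
  by rewrite lexx.
have /clusterP yr : cluster_left phi y 0 t <= cluster_right phi y 0 t <= cluster_right phi y 0 t.
  by rewrite lexx andbT.
have h1 : cluster_right phi y 0 t < be + t * e.
  rewrite ltNge; apply/negP => /(core_mono H t0); rewrite (yr t0); lra.
have h2 : be < cluster_left phi y 0 t.
  rewrite ltNge; apply/negP => /(core_mono H t0).
  by rewrite (yl t0) (phi_be H)// -/x; lra.
have /andP[v1 v2] := velocity_bounds y tp.
rewrite ler_norml; apply/andP; split.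
  have : t^-1 * (y - cluster_left phi y 0 t) <= t^-1 * (x - be + t * e).
    by rewrite ler_pM2l ?invr_gt0//; lra.
  by rewrite [X in _ <= X]mulrDr mulKf ?gt_eqF//; lra.
have : t^-1 * (x - be - t * e) <= t^-1 * (y - cluster_right phi y 0 t).
  by rewrite ler_pM2l ?invr_gt0//; lra.
by rewrite mulrBr mulKf ?gt_eqF//; lra.
Unshelve. all: by end_near.
Qed.

End flow.

Section shock_times.
Context {R : realType} (mu : {measure set (measurableTypeR R) -> \bar R}).
Variables (u : R -> R) (phi : R -> R -> R -> R).
Hypotheses (Hadm : admissible mu u) (Hflow : sticky_flow mu u phi).
Let H := flow_core Hadm Hflow.
Local Notation tau := (shock_time mu u phi).
Local Notation al := (left_end phi).
Local Notation be := (right_end phi).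

(* The negative jump condition is what makes these two equal. *)
Lemma isolated_no_jump t a : 0 < t -> al t a = be t a -> u0_minus mu u a = u0_plus mu u a.
Proof.
move=> tp e; have [hp hm] := adm_negative_jump Hadm a.
(* For [h < t * c] the error [t^-1 * h] in the one-sided means is less than [c]. *)
have d0 (c : R) : 0 < c -> nbhs (0^'+ : set_system R) [set h : R | 0 < h < t * c].
  move=> c0; have tc : 0 < t * c by rewrite mulr_gt0.
  by near=> h; rewrite /=; apply/andP; split.
have -> : u0_minus mu u a = (u a)%:E.
  apply/le_anti; rewrite hm andbT; apply/lee_addgt0Pr => c c0.
  rewrite /u0_minus limf_esupE; apply: ge_ereal_inf.
  exists (ereal_sup [set (average mu `[a - h, a[ u)%:E | h in [set h : R | 0 < h < t * c]]).
    by exists [set h : R | 0 < h < t * c] => //; exact: d0.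
  apply: ge_ereal_sup => _ [h /= /andP[h0 hc] <-]; rewrite -EFinD lee_fin.
  have ah : a - h < a by lra.
  apply: le_trans (isolated_average_left H tp e ah) _.
  by rewrite lerD2l opprB addrC subrK ler_pdivrMl// ltW.
apply/esym/le_anti; rewrite hp/=; apply/lee_subgt0Pr => c c0.
rewrite /u0_plus limf_einfE; apply: le_ereal_sup_tmp.
exists (ereal_inf [set (average mu `]a, a + h] u)%:E | h in [set h : R | 0 < h < t * c]]).
  by exists [set h : R | 0 < h < t * c] => //; exact: d0.
apply: le_ereal_inf_tmp => _ [h /= /andP[h0 hc] <-]; rewrite -EFinB lee_fin.
have ah : a < a + h by lra.
apply: le_trans (isolated_average_right H tp e ah).
by rewrite lerD2l lerN2 addrC addKr ler_pdivrMl// ltW.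
Unshelve. all: by end_near.
Qed.

Lemma shock_time_ge0 a : (0 <= tau a)%E.
Proof. by apply: le_ereal_inf_tmp => _ [t [t0 _] <-]; rewrite lee_fin. Qed.

(** Both ends move freely to the same position at time [r]; equal velocities would force them to
    coincide. *)
Lemma cluster_shock_time r a : 0 < r -> al r a < be r a -> (tau a <= r%:E)%E.
Proof.
move=> rp lt; apply: ge_ereal_inf; exists r%:E => //; exists r => //; split; first exact: ltW.
rewrite (velocity_minusE Hadm Hflow)// (velocity_plusE Hadm Hflow)// => -[e].
have A := core_al H a (ltW rp) (lexx r); have B := core_be H a (ltW rp) (lexx r).
by rewrite (phi_al H a (ltW rp)) in A; rewrite (phi_be H a (ltW rp)) in B; rewrite e in A; lra.
Qed.

(** A cluster reduced to a point at time [r] was so at all earlier times, which excludes an earlier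
    jump; at time 0 this is [isolated_no_jump]. *)
Lemma shock_time_cluster r a : (tau a < r%:E)%E -> al r a < be r a.
Proof.
move=> /ereal_inf_lt[_ [s [s0 neq] <-]]; rewrite lte_fin => sr.
have r0 : 0 <= r by lra.
rewrite lt_neqAle (al_le_be H a r0) andbT; apply/eqP => e; apply: neq.
move: s0; rewrite le_eqVlt => /orP[/eqP s0|sp].
  rewrite -s0 (core_id H) /velocity_minus /velocity_plus eqxx.
  by apply: isolated_no_jump e; lra.
rewrite (velocity_minusE Hadm Hflow)// (velocity_plusE Hadm Hflow)//; congr (u _)%:E.
have s0 := ltW sp; have sr' := ltW sr.
have := al_nest H a s0 sr'; have := be_nest H a s0 sr'; have := al_le_be H a s0; lra.
Qed.

Lemma isolated_before t a : 0 <= t -> (t%:E < tau a)%E -> al t a = a /\ be t a = a.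
Proof.
move=> t0 lt; have nlt : ~ al t a < be t a.
  move: t0; rewrite le_eqVlt => /orP[/eqP <-|tp].
    by rewrite (al0 H) (be0 H) ltxx.
  by move=> /(cluster_shock_time tp); rewrite leNgt lt.
by move/negP: nlt; rewrite -leNgt => ge; have /andP[] := albe_in H a t0; split; lra.
Qed.

Lemma free_before t a : 0 <= t -> (t%:E < tau a)%E -> phi 0 t a = a + t * u a.
Proof.
by move=> t0 lt; have [e _] := isolated_before t0 lt; rewrite -{1}e (core_al H a t0 (lexx t)) e.
Qed.

(** The midpoint is positive even when [tau c] is 0, which provides a non-trivial cluster at a
    positive time before [T]. *)
Lemma shock_time_between T c : (tau c < T%:E)%E ->
  exists r, [/\ 0 < r, r < T & (tau c < r%:E)%E].
Proof.
move=> lt; have := shock_time_ge0 c; case: (tau c) lt => [v||]//; rewrite lte_fin lee_fin => vT v0.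
by exists ((v + T) / 2); rewrite lte_fin; split; lra.
Qed.

Section finite_shock.
Variables (a T : R).
Hypothesis aT : tau a = T%:E.

Let T0 : 0 <= T. Proof. by have := shock_time_ge0 a; rewrite aT lee_fin. Qed.

Lemma cluster_shock_le c : phi 0 T c = phi 0 T a -> (tau c <= T%:E)%E.
Proof.
move=> e; have [e1 e2] := cluster_eq H T0 e.
have := al_le_be H a T0; rewrite le_eqVlt => /orP[/eqP ae|lt].
  have -> : c = a; last by rewrite aT.
  by have /andP[] := albe_in H a T0; have /andP[] := albe_in H c T0; lra.
have Tp : 0 < T.
  by rewrite lt_neqAle T0 andbT; apply/eqP => Te; move: lt; rewrite -Te (al0 H) (be0 H) ltxx.
by apply: cluster_shock_time => //; rewrite e1 e2.
Qed.

(** A shock before [T] would put [c] in a non-trivial cluster before [T], which [al_isolated] and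
    [be_isolated] forbid. *)
Lemma endpoint_shock_time c : al T c = c \/ be T c = c -> phi 0 T c = phi 0 T a ->
  tau c = T%:E.
Proof.
move=> ce e; apply/le_anti; rewrite cluster_shock_le//= leNgt; apply/negP.
move=> /shock_time_between[r [rp rT /shock_time_cluster]]; have r0 := ltW rp.
case: ce => ce.
  by rewrite (al_isolated H r0 rT ce) (al_fix_nest H r0 (ltW rT) ce) ltxx.
by rewrite (be_isolated H r0 rT ce) (be_fix_nest H r0 (ltW rT) ce) ltxx.
Qed.

Let S := turbulent mu u phi a.

Let SP : shock_together mu u phi a S.
Proof. by have [|] := @turbulent_greatest R mu u phi a; rewrite ?aT. Qed.

Lemma turbulent_mem : S a.
Proof. by have [_ ? _] := SP. Qed.

Lemma turbulent_shock c : S c -> tau c = T%:E /\ al T a <= c <= be T a.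
Proof.
have [_ _ h] := SP => /h; rewrite aT /= => -[-> e]; split=> //.
exact/(core_cluster H _ _ T0).
Qed.

(* A limit c of S cannot be an endpoint of a cluster formed before T, and so
   that cluster would contain points of S. *)
Lemma turbulent_adherent c : (forall e, 0 < e -> exists2 b, S b & `|b - c| < e) ->
  al T a <= c <= be T a /\ tau c = T%:E.
Proof.
move=> adh; have cin : al T a <= c <= be T a.
  apply/andP; split; rewrite leNgt; apply/negP => lt.
    have [|b /turbulent_shock[_ /andP[h1 h2]]] := adh (al T a - c); first lra.
    by rewrite ltr_norml => /andP[]; lra.
  have [|b /turbulent_shock[_ /andP[h1 h2]]] := adh (c - be T a); first lra.
  by rewrite ltr_norml => /andP[]; lra.
split; first exact: cin.
have e : phi 0 T c = phi 0 T a by exact/(core_cluster H _ _ T0).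
apply/le_anti; rewrite cluster_shock_le//= leNgt; apply/negP.
move=> /shock_time_between[r [rp rT tr]]; have r0 := ltW rp.
(* The ends of a cluster at [r] are alone at the earlier time [s]. Since the cluster of [c] at [s]
   is non-trivial, [c] is strictly inside its cluster at [r]. *)
have [s [sp sr /shock_time_cluster ts]] := shock_time_between tr; have s0 := ltW sp.
have /andP := albe_in H c r0; rewrite !le_eqVlt => -[/orP[/eqP ce|cl] /orP[/eqP ce'|cr]].
- by move: ts; rewrite (al_isolated H s0 sr ce) (al_fix_nest H s0 (ltW sr) ce) ltxx.
- by move: ts; rewrite (al_isolated H s0 sr ce) (al_fix_nest H s0 (ltW sr) ce) ltxx.
- by move/esym in ce'; move: ts; rewrite (be_isolated H s0 sr ce') (be_fix_nest H s0 (ltW sr) ce') ltxx.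
(* A point of [S] this close to [c] shares its cluster at [r], so its shock time is at most [r],
   hence less than [T]. *)
have m0 : 0 < Num.min (c - al r c) (be r c - c) by rewrite lt_min !subr_gt0 cl cr.
have [b Sb] := adh _ m0; rewrite lt_min !ltr_norml => /andP[/andP[b1 b2] /andP[b3 b4]].
have be' : phi 0 r b = phi 0 r c by apply/(core_cluster H _ _ r0); apply/andP; split; lra.
have [e1 e2] := cluster_eq H r0 be'.
have [+ _] := turbulent_shock Sb; have := @cluster_shock_time r b rp.
rewrite e1 e2 (shock_time_cluster tr) => /(_ isT) h hb.
by move: h; rewrite hb lee_fin; lra.
Qed.

Let S_lb : has_inf S.
Proof.
split; first by exists a; exact: turbulent_mem.
by exists (al T a) => b /turbulent_shock[_ /andP[]].
Qed.

Let S_ub : has_sup S.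
Proof.
split; first by exists a; exact: turbulent_mem.
by exists (be T a) => b /turbulent_shock[_ /andP[]].
Qed.

Lemma turbulent_left_shock : al T a <= turbulent_left mu u phi a <= be T a /\
  tau (turbulent_left mu u phi a) = T%:E.
Proof.
apply: turbulent_adherent => e e0; have [b Sb bl] := inf_adherent e0 S_lb.
exists b => //; have : inf S <= b by apply: ge_inf => //; exact: S_lb.2.
by move=> ?; rewrite ltr_norml; apply/andP; split; rewrite -/S /turbulent_left -/S; lra.
Qed.

Lemma turbulent_right_shock : al T a <= turbulent_right mu u phi a <= be T a /\
  tau (turbulent_right mu u phi a) = T%:E.
Proof.
apply: turbulent_adherent => e e0; have [b Sb bl] := sup_adherent e0 S_ub.
exists b => //; have : b <= sup S by apply: ub_le_sup => //; exact: S_ub.2.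
by move=> ?; rewrite ltr_norml; apply/andP; split; rewrite -/S /turbulent_right -/S; lra.
Qed.

Lemma turbulent_left_le : turbulent_left mu u phi a <= a.
Proof. by apply: ge_inf; [exact: S_lb.2|exact: turbulent_mem]. Qed.

Lemma turbulent_right_ge : a <= turbulent_right mu u phi a.
Proof. by apply: ub_le_sup; [exact: S_ub.2|exact: turbulent_mem]. Qed.

(** If the order were reversed at [T], the lines would cross at [d / k] in [[0, T[], and the
    midpoint between the crossing and [T] would violate the hypothesis. *)
Let affine_le (p q p' q' : R) : 0 < T ->
  (forall s, 0 <= s -> s < T -> p + s * q <= p' + s * q') -> p + T * q <= p' + T * q'.
Proof.
move=> Tp h; rewrite leNgt; apply/negP => lt.
have h0 := h 0 (lexx 0) Tp; rewrite !mul0r !addr0 in h0.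
pose k := q - q'; pose d := p' - p.
have kp : 0 < k by rewrite /k; nra.
have dk : d / k < T by rewrite ltr_pdivrMr// /d /k; lra.
have dk0 : 0 <= d / k by apply: divr_ge0; [rewrite /d; lra|exact: ltW].
have dE : d / k * k = d by rewrite divfK ?gt_eqF.
move: (d / k) dk dk0 dE => w wT w0 wE; rewrite /d /k in wE.
have w1 : 0 <= (w + T) / 2 by lra.
have w2 : (w + T) / 2 < T by lra.
by have := h _ w1 w2; nra.
Qed.

(* phi_s(c) is squeezed between the free endpoints of the cluster for s < T. *)
Lemma free_until_shock c : al T a <= c <= be T a -> tau c = T%:E ->
  forall t, 0 <= t -> t <= T -> phi 0 t c = c + t * u c.
Proof.
move=> /andP[ac cb] cT t t0; rewrite le_eqVlt => /orP[/eqP ->|tT]; last first.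
  by apply: free_before => //; rewrite cT lte_fin.
have cx : phi 0 T c = phi 0 T a by apply/(core_cluster H _ _ T0); rewrite ac.
rewrite cx; move: (T0); rewrite le_eqVlt => /orP[/eqP Te|Tp].
  by move: cx; rewrite -Te !(core_id H) mul0r addr0.
have A s : 0 <= s -> s <= T -> phi 0 s (al T a) = al T a + s * u (al T a).
  by move=> *; exact: (core_al H).
have B s : 0 <= s -> s <= T -> phi 0 s (be T a) = be T a + s * u (be T a).
  by move=> *; exact: (core_be H).
have F s : 0 <= s -> s < T -> phi 0 s c = c + s * u c.
  by move=> s0 sT; apply: free_before => //; rewrite cT lte_fin.
have low : al T a + T * u (al T a) <= c + T * u c.
  apply: affine_le => // s s0 sT; rewrite -(A _ s0 (ltW sT)) -(F _ s0 sT).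
  exact: (core_mono H).
have high : c + T * u c <= be T a + T * u (be T a).
  apply: affine_le => // s s0 sT; rewrite -(B _ s0 (ltW sT)) -(F _ s0 sT).
  exact: (core_mono H).
rewrite -(A _ T0 (lexx T)) (phi_al H)// in low.
rewrite -(B _ T0 (lexx T)) (phi_be H)// in high.
by apply/le_anti; rewrite low high.
Qed.

(** The left end of the turbulent interval moves freely until [T], when it is in the cluster of
    [a]. *)
Lemma shock_positionE : shock_position mu u phi a = phi 0 T a.
Proof.
have [cin cT] := turbulent_left_shock; rewrite /shock_position cT /=.
rewrite -(free_until_shock cin cT T0 (lexx T)).
exact/(core_cluster H _ _ T0).
Qed.

End finite_shock.
End shock_times.

(** * Trajectories of the four processes *)

Section trajectories.
Context {R : realType} (mu : {measure set (measurableTypeR R) -> \bar R}).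
Variables (u : R -> R) (phi : R -> R -> R -> R).
Hypotheses (Hadm : admissible mu u) (Hflow : sticky_flow mu u phi).
Let H := flow_core Hadm Hflow.
Local Notation tau := (shock_time mu u phi).

(** What the starting points of [Z1] to [Z4] have in common, apart from their order. *)
Definition shock_companion (a c : R) := [/\ tau c = tau a,
  forall t, 0 <= t -> (t%:E <= tau a)%E -> phi 0 t c = c + t * u c &
  forall t, 0 <= t -> (tau a <= t%:E)%E -> phi 0 t c = phi 0 t a].

Lemma companion_infinite a : tau a = +oo%E -> shock_companion a a.
Proof.
move=> ay; split=> // t t0 _; apply: (free_before Hadm Hflow) => //.
by rewrite ay ltry.
Qed.

Lemma companion_finite a T c : tau a = T%:E ->
  left_end phi T a <= c <= right_end phi T a -> tau c = T%:E -> shock_companion a c.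
Proof.
move=> aT cin cT; split; first by rewrite aT.
  by move=> t t0; rewrite aT lee_fin; exact: (free_until_shock Hadm Hflow aT cin cT).
have T0 : 0 <= T by have := shock_time_ge0 mu u phi a; rewrite aT lee_fin.
move=> t t0; rewrite aT lee_fin => Tt.
by apply: (core_nest H T0 Tt); exact/(core_cluster H _ _ T0).
Qed.

Lemma shock_times_cases a : tau a = +oo%E \/ exists2 T, 0 <= T & tau a = T%:E.
Proof.
have := shock_time_ge0 mu u phi a; case: (tau a) => [T| |]//; last by left.
by rewrite lee_fin => T0; right; exists T.
Qed.

(** Each process follows the flow from a fixed starting point, so the order of these points passes
    to all times by monotonicity of the flow. *)
Lemma companions a : exists c : R * R * R * R, let: (c1, c2, c3, c4) := c in
  [/\ forall t, Z1 mu u phi t a = phi 0 t c1, forall t, Z2 mu u phi t a = phi 0 t c2,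
      forall t, Z3 mu u phi t a = phi 0 t c3 & forall t, Z4 mu u phi t a = phi 0 t c4] /\
  [/\ shock_companion a c1, shock_companion a c2, shock_companion a c3 &
      shock_companion a c4] /\ [/\ c3 <= c1, c1 <= a, a <= c2 & c2 <= c4].
Proof.
have [ay|[T T0 aT]] := shock_times_cases a.
  have ca := companion_infinite ay.
  by exists (a, a, a, a); split; [split=> t; rewrite /Z1 /Z2 /Z3 /Z4 ay eqxx|].
have [lin lT] := turbulent_left_shock Hadm Hflow aT.
have [rin rT] := turbulent_right_shock Hadm Hflow aT.
exists (turbulent_left mu u phi a, turbulent_right mu u phi a,
  left_end phi T a, right_end phi T a); split; [|split].
- split=> t; rewrite /Z1 /Z2 /Z3 /Z4 aT //=.
    by rewrite lT (shock_positionE Hadm Hflow aT).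
  by rewrite lT (shock_positionE Hadm Hflow aT).
- split.
  + exact: (companion_finite aT lin lT).
  + exact: (companion_finite aT rin rT).
  + apply: (companion_finite aT); first by rewrite lexx (al_le_be H).
    by apply: (endpoint_shock_time Hadm Hflow aT); [left; exact: (al_al H)|exact: (phi_al H)].
  + apply: (companion_finite aT); first by rewrite lexx (al_le_be H).
    by apply: (endpoint_shock_time Hadm Hflow aT); [right; exact: (be_be H)|exact: (phi_be H)].
- have /andP[? _] := lin; have /andP[_ ?] := rin; split=> //.
    exact: (turbulent_left_le Hadm Hflow aT).
  exact: (turbulent_right_ge Hadm Hflow aT).
Qed.

Lemma velocity_derivative t y : 0 < t ->
  is_right_derivative (fun r => phi 0 r y) t (velocity mu u phi (phi 0 t y) t).
Proof.
move=> tp; rewrite /velocity; case: ifPn => [lt|].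
  exact: (cluster_derivative H (ltW tp) lt).
rewrite -leNgt => ge; apply: (isolated_derivative H tp).
by apply/le_anti; rewrite (al_le_be H y (ltW tp)).
Qed.

Lemma velocity0 y : velocity mu u phi (phi 0 0 y) 0 = u y.
Proof.
by rewrite /velocity -/(left_end phi 0 y) -/(right_end phi 0 y) (al0 H) (be0 H) ltxx.
Qed.

(** At time 0, either [tau a] is 0 and [c] is [a] itself, or [c] moves freely for a while and its
    difference quotient is constant. *)
Lemma companion_derivative a c t : shock_companion a c ->
  is_right_derivative (fun r => phi 0 r a) 0 (u a) -> 0 <= t ->
  is_right_derivative (fun r => phi 0 r c) t (velocity mu u phi (phi 0 t c) t).
Proof.
move=> [cT free late] da; rewrite le_eqVlt => /orP[/eqP <-|]; last exact: velocity_derivative.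
rewrite velocity0; have := shock_time_ge0 mu u phi a.
rewrite le_eqVlt => /orP[/eqP a0|ap].
  have := late 0 (lexx 0); rewrite -a0 => /(_ (lexx _)).
  by rewrite !(core_id H) => ->.
have [r rp ra] : exists2 r, 0 < r & (r%:E <= tau a)%E.
  have [ay|[T _ aT]] := shock_times_cases a; first by exists 1; rewrite ?ay ?leey.
  by exists T; [move: ap; rewrite aT lte_fin|rewrite aT].
rewrite /is_right_derivative; apply: cvg_near_cst; near=> h.
have h0 : 0 < h by [].
have hr : h <= r by near: h; exact: nbhs_right_le.
have hE : (h%:E <= tau a)%E by apply: le_trans ra; rewrite lee_fin.
by rewrite add0r (core_id H) (free h (ltW h0) hE) [_ + h * _]addrC addrK mulKf ?gt_eqF.
Unshelve. all: by end_near.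
Qed.

End trajectories.

Unset Implicit Arguments.

Theorem proposition3p1 (R : realType)
    (mu0 : {measure set (measurableTypeR R) -> \bar R}) (u0 : R -> R)
    (phi : R -> R -> R -> R)
    (d : measure_display) (Omega : measurableType d)
    (P : {measure set Omega -> \bar R}) (X0 : Omega -> measurableTypeR R)
    (Hadm : admissible mu0 u0)
    (Hflow : sticky_flow mu0 u0 phi)
    (HX0 : measurable_fun setT X0)
    (Hlaw : forall B : set (measurableTypeR R), measurable B ->
      pushforward P X0 B = mu0 B) :
  let tau := shock_time mu0 u0 phi in
  let u := velocity mu0 u0 phi in
  let gamma : Omega -> \bar R := fun w => tau (X0 w) in
  let Xp : R -> Omega -> R := fun t w => X phi t (X0 w) in
  let Zp1 : R -> Omega -> R := fun t w => Z1 mu0 u0 phi t (X0 w) in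
  let Zp2 : R -> Omega -> R := fun t w => Z2 mu0 u0 phi t (X0 w) in
  let Zp3 : R -> Omega -> R := fun t w => Z3 mu0 u0 phi t (X0 w) in
  let Zp4 : R -> Omega -> R := fun t w => Z4 mu0 u0 phi t (X0 w) in
  {ae P, forall w : Omega,
    (forall Z : R -> Omega -> R,
      [\/ Z = Zp1, Z = Zp2, Z = Zp3 | Z = Zp4] ->
      (forall s t : R, 0 <= s -> 0 <= t ->
        Z (s + t) w = phi s t (Z s w)) /\
      (forall t : R, 0 <= t ->
        is_right_derivative (fun r => Z r w) t (u (Z t w) t))) /\
    (forall Z : R -> Omega -> R,
      [\/ Z = Zp1, Z = Zp2, Z = Zp3 | Z = Zp4] ->
      [/\ tau (Z 0 w) = tau (X0 w) /\ tau (X0 w) = gamma w,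
          forall t : R, 0 <= t -> (gamma w <= t%:E)%E -> Z t w = Xp t w &
          forall t : R, 0 <= t -> (t%:E <= gamma w)%E ->
            Z t w = Z 0 w + t * u0 (Z 0 w) /\
            [/\ Zp3 t w <= Zp1 t w, Zp1 t w <= Xp t w,
                Xp t w <= Zp2 t w & Zp2 t w <= Zp4 t w]])}.
Proof.
move=> tau u gamma Xp Zp1 Zp2 Zp3 Zp4.
(* The exceptional set is the preimage under [X0] of the null set for the initial velocity; it is
   null because [X0] has image measure [mu0]. *)
have [N [mN N0 NP]] := initial_velocity (flow_core Hadm Hflow).
exists (X0 @^-1` N); split.
- by rewrite -[X in measurable X]setTI; exact: HX0.
- by have := Hlaw N mN; rewrite N0.
move=> w nQ; apply: contrapT => nN; apply: nQ.
have [[[[c1 c2] c3] c4] [[E1 E2 E3 E4] [[C1 C2 C3 C4] [c31 c1a ac2 c24]]]] :=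
  companions Hadm Hflow (X0 w).
have ZP Z : [\/ Z = Zp1, Z = Zp2, Z = Zp3 | Z = Zp4] ->
    exists2 c, shock_companion mu0 u0 phi (X0 w) c & forall t, Z t w = phi 0 t c.
  by case=> ->; [exists c1|exists c2|exists c3|exists c4].
have mono t : 0 <= t -> {homo phi 0 t : x y / x <= y}.
  by move=> t0; exact: (flow_nondecreasing Hflow (lexx 0) t0).
split=> Z /ZP[c C ZE].
  split=> [s t s0 t0|t t0].
    by rewrite !ZE (flow_semigroup Hflow).
  have -> : (fun r => Z r w) = (fun r => phi 0 r c) by apply/funext => r; exact: ZE.
  by rewrite ZE; exact: (companion_derivative Hadm Hflow C (NP _ nN)).
have Z0 : Z 0 w = c by rewrite ZE (flow_id Hflow).
have [cT free late] := C; rewrite Z0; split; first by split; [exact: cT|exact: erefl].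
  by move=> t t0 ht; rewrite ZE; exact: late.
move=> t t0 ht; rewrite ZE; split; first exact: free.
rewrite /Zp1 /Zp2 /Zp3 /Zp4 /Xp E1 E2 E3 E4.
by split; apply: (mono t t0).
Qed.
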